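(* Let $G$ be an oriented graph on a surface, with orientation $\sigma$. Then for every integer $k\ge 0$, $|\tau^{loc}_{\mathbb{Z}}(G;-k)|$ is equal to the number of pairs $(t,\mathfrak{o})$, where $t$ is an integral $(k+1)$-local tension of $G$ and $\mathfrak{o}$ is a boundary acyclic orientation of $G$ compatible with $t$. In particular, the absolute value of the constant term $\tau^{loc}_{\mathbb{Z}}(G;0)$ is equal to the number of boundary acyclic orientations of $G$.
   Context: Graphs may have loops and multiple edges. A graph on a surface $G=(V,E,F)$ is a graph $(V,E)$ cellularly embedded in a closed oriented (not necessarily connected) surface $\Sigma$, i.e. $\Sigma\setminus G$ is a disjoint union of discs, the faces, forming the set $F$. An oriented graph on a surface has a fixed orientation $\sigma$ of its edges. Boundary: for $F'\subseteq F$, $\partial F'$ is the set of edges having two distinct adjacent faces exactly one of which belongs to $F'$. Each edge of $\partial F'$ has a natural direction, giving $\overrightarrow{\partial F'}$: the direction induced by the orientation of its adjacent face $f\in F'$ as a submanifold of $\Sigma$. For an orientation $\mathfrak{o}$, $\overrightarrow{\partial_{\mathfrak{o}}F'}\in\{0,\pm1\}^E$ has $e$-entry $0$ if $e\notin\partial F'$, $1$ if the direction of $e$ in $\overrightarrow{\partial F'}$ agrees with $\mathfrak{o}$, $-1$ if it disagrees. Write $\partial f$, $\overrightarrow{\partial_{\mathfrak{o}}f}$ when $F'=\{f\}$. A nonempty boundary $\partial F'$ is coherently oriented with respect to $\mathfrak{o}$ if the nonzero entries of $\overrightarrow{\partial_{\mathfrak{o}}F'}$ are all $+1$ or all $-1$.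 A boundary acyclic orientation is an orientation of $G$ with no coherently oriented (nonempty) boundary. For a positive integer $k$, an integral $k$-local tension is a map $t:E\to\{-(k-1),\dots,-1,0,1,\dots,k-1\}$ such that $\sum_{e\in\partial f}\overrightarrow{\partial_\sigma f}(e)\,t(e)=0$ (in $\mathbb{Z}$) for each face $f$. For positive integers $k$, $\tau^{loc}_{\mathbb{Z}}(G;k)$ is the number of nowhere-zero integral $k$-local tensions of $G$; as a function of $k$ it is given by a quasipolynomial, and values at nonpositive integers are those of this quasipolynomial. An integral local tension $t$ and a boundary acyclic orientation $\mathfrak{o}$ are compatible if $\mathfrak{o}$ agrees with $\sigma$ on every edge $e$ with $t(e)>0$ and disagrees with $\sigma$ on every edge $e$ with $t(e)<0$. *)

(* Defs.v *)
From mathcomp Require Import all_boot all_order all_fingroup all_algebra.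

Set Implicit Arguments.
Unset Strict Implicit.
Unset Printing Implicit Defensive.

Import Order.TTheory GRing.Theory Num.Theory.
Local Open Scope ring_scope.

(** A graph cellularly embedded in a closed oriented, possibly disconnected,
    surface is encoded by its combinatorial map.  A dart is an edge together
    with a direction; [dart_rev] reverses it, [tail] is the vertex it leaves,
    [vertex_rot] is the counterclockwise successor among the darts leaving the
    same vertex, and [left] is the face on its left.  Keeping the face on the
    left, the dart after [d] is the clockwise successor of [dart_rev d], so the
    darts with a given face on their left form an orbit of [face_perm]
    (products of permutations act left to right).
    Loops and multiple edges are allowed.  A vertex with no dart lies on its
    own sphere component, whose only face has no adjacent edge; hence
    [sg_isolated]. *)
Record surface_graph := SurfaceGraph {
  vertex : finType;
  edge : finType;
  face : finType;
  dart : finType;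
  dart_rev : {perm dart};
  vertex_rot : {perm dart};
  edge_of : dart -> edge;
  tail : dart -> vertex;
  left : dart -> face;
  face_perm := (dart_rev * vertex_rot^-1)%g;
  sg_revK : involutive dart_rev;
  sg_rev_neq : forall d, dart_rev d != d;
  sg_edge_of_surj : forall e, exists d, edge_of d = e;
  sg_edge_of : forall d d',
    (edge_of d == edge_of d') = (d' == d) || (d' == dart_rev d);
  sg_tail : forall d d', (tail d == tail d') = (d' \in porbit vertex_rot d);
  sg_left : forall d d', (left d == left d') = (d' \in porbit face_perm d);
  sg_isolated :
    #|[set v | v \notin codom tail]| = #|[set f | f \notin codom left]|
}.

Section Orientations.
Variable G : surface_graph.

(** An orientation chooses one of the two darts of each edge. *)
Definition orientation : Type :=
  {o : {ffun edge G -> dart G} | [forall e, edge_of (o e) == e]}.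

Definition odart (o : orientation) (e : edge G) : dart G := val o e.

Definition agree (o1 o2 : orientation) (e : edge G) : bool :=
  odart o1 e == odart o2 e.

Definition adjacent_faces (e : edge G) : {set face G} :=
  [set left d | d : dart G & edge_of d == e].

Definition boundary (F' : {set face G}) : {set edge G} :=
  [set e | (#|adjacent_faces e| == 2)%N && (#|adjacent_faces e :&: F'| == 1)%N].

(** The boundary orientation of a face keeps the face on its left. *)
Definition boundary_vec (o : orientation) (F' : {set face G}) (e : edge G)
    : int :=
  if e \notin boundary F' then 0
  else if left (odart o e) \in F' then 1 else -1.

Definition coherently_oriented (o : orientation) (F' : {set face G}) : bool :=
  [forall e, (boundary_vec o F' e != 0) ==> (boundary_vec o F' e == 1)] ||
  [forall e, (boundary_vec o F' e != 0) ==> (boundary_vec o F' e == -1)].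

Definition boundary_acyclic (o : orientation) : bool :=
  ~~ [exists F' : {set face G},
       (boundary F' != set0) && coherently_oriented o F'].

Definition local_tension (sigma : orientation) (t : edge G -> int) : bool :=
  [forall f : face G,
    \sum_(e in boundary [set f]) boundary_vec sigma [set f] e * t e == 0].

Definition compatible (sigma : orientation) (t : edge G -> int)
    (o : orientation) : bool :=
  [forall e, ((0 < t e) ==> agree o sigma e) &&
             ((t e < 0) ==> ~~ agree o sigma e)].

End Orientations.

(** For [0 < k], the finite type indexing the integers
    [-(k-1), ..., k-1], the index [i] standing for [i - (k-1)]. *)
Definition kvalue (k : nat) : finType := 'I_(k.*2.-1).

Definition kval (k : nat) (i : kvalue k) : int := (i : nat)%:Z - k.-1%:Z.

Section Tensions.
Variables (G : surface_graph) (sigma : orientation G) (k : nat).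

Definition klocal_tensions : {set {ffun edge G -> kvalue k}} :=
  [set t : {ffun edge G -> kvalue k}
     | local_tension sigma (fun e => kval (t e))].

Definition tau_loc : nat :=
  #|[set t in klocal_tensions | [forall e : edge G, kval (t e) != 0]]|.

Definition compatible_pairs
    : {set {ffun edge G -> kvalue k} * orientation G} :=
  [set p : {ffun edge G -> kvalue k} * orientation G
     | [&& p.1 \in klocal_tensions, boundary_acyclic p.2
         & compatible sigma (fun e => kval (p.1 e)) p.2]].

End Tensions.

Definition quasipolynomial (q : int -> rat) : Prop :=
  exists (m : nat) (c : int -> {poly rat}),
    [/\ (0 < m)%N, forall n : int, c (n + m%:Z) = c n
      & forall n : int, q n = (c n).[n%:~R]].

(** Such a [q] is unique, since a quasipolynomial is determined by its values
    at the positive integers. *)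
Definition is_tau_loc_quasipolynomial (G : surface_graph)
    (sigma : orientation G) (q : int -> rat) : Prop :=
  quasipolynomial q /\
  forall k : nat, (0 < k)%N -> q k%:Z = (tau_loc sigma k)%:R.

(* Main.v *)
Require Import Defs.
From mathcomp Require Import all_boot all_order all_fingroup all_algebra.
From Stdlib Require Import Classical.
From mathcomp Require Import zify ring.

Set Implicit Arguments.
Unset Strict Implicit.
Unset Printing Implicit Defensive.

Import Order.TTheory GRing.Theory Num.Theory.
Local Open Scope ring_scope.

(** The local tensions of [G] are the flows of the dual graph, and by Minty's
    lemma the boundary acyclic orientations are those which carry a strictly
    positive flow.  Hence [tau_loc] at [k] counts the interior lattice points of
    the [k]-th dilates of the polytopes [P_o] of flows with values in [0, 1], one
    for each boundary acyclic orientation [o], and the theorem is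
    Ehrhart-Macdonald reciprocity for these polytopes.

    Reciprocity is proved for half-open polytopes: given a generic flow [w] and
    an integer [u], the facets [x f = 0] with [w f < 0] and [x f = k] with
    [u < w f] are removed; passing to [(-w, -u)] exchanges the removed and the
    kept facets.  The nonzero points are sorted by the edge [e] where [x] is
    maximal, ties being broken by [w], and by the maximum [j].  If [e] lies on a
    directed cycle [v], the substitution [x -> j - x] on [v] turns the points of
    the class [(e, j)] into the points of dilate [j] of a polytope of the same
    kind on the other edges, with [w] reflected likewise and [w e] in place of
    [u].  So counting functions are obtained from those with one edge less by
    summation over [j], and reciprocity follows by induction, the value at [0]
    being carried along.  The point [w] plays the role of a generic point in
    Stanley's half-open decompositions and makes Euler's relation unnecessary. *)

(** * Summation of polynomials *)

(** Rising factorials are to the backward difference what powers are to the derivative. *)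
Definition rising_poly (n : nat) : {poly rat} :=
  \prod_(0 <= i < n) ('X - (- i%:R)%:P).

Lemma rising_polyS n (z : rat) :
  (rising_poly n.+1).[z] - (rising_poly n.+1).[z - 1] =
  n.+1%:R * (rising_poly n).[z].
Proof.
rewrite /rising_poly {1}big_nat_recr //= big_nat_recl //= !hornerM !horner_prod.
have -> : \prod_(0 <= i < n) ('X - (- i.+1%:R)%:P).[z - 1]
          = \prod_(0 <= i < n) ('X - (- i%:R)%:P).[z].
  by apply: eq_bigr => i _; rewrite !hornerXsubC -natr1; ring.
rewrite !hornerXsubC -natr1; ring.
Qed.

(** Induction on the size: a multiple of a rising factorial cancels the leading term, and is itself
    summed by the next rising factorial. *)
Lemma summation_poly (p : {poly rat}) :
  exists S : {poly rat}, S.[0] = 0 /\ forall z, S.[z] - S.[z - 1] = p.[z].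
Proof.
suff [S HS] : exists S : {poly rat}, forall z, S.[z] - S.[z - 1] = p.[z].
  exists (S - S.[0]%:P); rewrite !hornerE; split=> [|z]; first by rewrite subrr.
  by rewrite !hornerE -HS; ring.
have [n] := ubnP (size p); elim: n p => // n IHn p.
rewrite ltnS leq_eqVlt => /predU1P[sz_p|]; last exact: IHn.
case: n => [|n] in IHn sz_p *.
  move/eqP: sz_p; rewrite size_poly_eq0 => /eqP->; exists 0 => z.
  by rewrite !horner0 subr0.
have monr : rising_poly n \is monic by apply: monic_prod_XsubC.
have szr : size (rising_poly n) = n.+1.
  by rewrite size_prod_XsubC size_iota subn0.
have [|S HS] := IHn (p - lead_coef p *: rising_poly n).
  have szB : (size (p - lead_coef p *: rising_poly n)%R <= n.+1)%N.
    rewrite (leq_trans (size_polyD _ _)) // size_polyN geq_max sz_p leqnn.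
    by rewrite (leq_trans (size_scale_leq _ _)) ?szr.
  rewrite ltn_neqAle szB andbT; apply/eqP => szn.
  suff: lead_coef (p - lead_coef p *: rising_poly n) == 0.
    by rewrite lead_coef_eq0 -size_poly_eq0 szn.
  have rn : (rising_poly n)`_n = 1.
    by apply/eqP; move: monr; rewrite monicE lead_coefE szr.
  have pn : p`_n = lead_coef p by rewrite lead_coefE sz_p.
  by rewrite [lead_coef (p - _)]lead_coefE szn coefB coefZ /= rn pn mulr1 subrr.
exists (S + (lead_coef p / n.+1%:R) *: rising_poly n.+1) => z.
have Hd := rising_polyS n z; have {HS} := HS z.
rewrite !hornerE => HS.
have nz : n.+1%:R != 0 :> rat by rewrite pnatr_eq0.
have -> : S.[z] + lead_coef p / n.+1%:R * (rising_poly n.+1).[z]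
  - (S.[z - 1] + lead_coef p / n.+1%:R * (rising_poly n.+1).[z - 1])
  = (S.[z] - S.[z - 1]) + lead_coef p / n.+1%:R *
    ((rising_poly n.+1).[z] - (rising_poly n.+1).[z - 1]) by ring.
by rewrite Hd HS mulrA divfK // subrK.
Qed.

Lemma summation_poly_pos (p S : {poly rat}) :
  S.[0] = 0 -> (forall z, S.[z] - S.[z - 1] = p.[z]) ->
  forall k : nat, S.[k%:R] = \sum_(1 <= j < k.+1) p.[j%:R].
Proof.
move=> S0 HS; elim=> [|k IHk]; first by rewrite big_geq.
rewrite big_nat_recr //= -IHk -HS -natr1 addrK addrC subrK //.
Qed.

(** The range starts at [0] here but at [1] for positive arguments. This shift is what exchanges
    removed and kept facets, and it is why values at [0] must be known. *)
Lemma summation_poly_neg (p S : {poly rat}) :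
  S.[0] = 0 -> (forall z, S.[z] - S.[z - 1] = p.[z]) ->
  forall k : nat, S.[- k%:R] = - \sum_(0 <= j < k) p.[- j%:R].
Proof.
move=> S0 HS; elim=> [|k IHk]; first by rewrite big_geq // !oppr0.
rewrite big_nat_recr //= opprD -IHk -HS -natr1 opprD; ring.
Qed.

(** * Lattice points in a box *)

Section Counting.
Variable E : finType.
Implicit Types (k l : nat) (P Q : pred {ffun E -> nat}).

Definition nat_ffun k (x : {ffun E -> 'I_k.+1}) : {ffun E -> nat} := [ffun e => x e : nat].

(** The predicate lives on functions into [nat], so that the same predicate can be counted in boxes
    of different sizes. *)
Definition box_count k P : nat := #|[set x : {ffun E -> 'I_k.+1} | P (nat_ffun x)]|.

Lemma nat_ffun_inj k : injective (@nat_ffun k).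
Proof.
move=> x y /ffunP xy; apply/ffunP=> e; apply: val_inj.
by have := xy e; rewrite !ffunE.
Qed.

Lemma eq_box_count k P Q :
  (forall x : {ffun E -> nat}, (forall e, (x e <= k)%N) -> P x = Q x) ->
  box_count k P = box_count k Q.
Proof.
move=> PQ; apply: eq_card => x; rewrite !inE; apply: PQ => e.
by rewrite ffunE -ltnS ltn_ord.
Qed.

Lemma box_count_le k l P Q (f g : {ffun E -> nat} -> {ffun E -> nat}) :
    (forall x : {ffun E -> nat}, (forall e, (x e <= k)%N) -> P x ->
       [/\ forall e, (f x e <= l)%N, Q (f x) & g (f x) = x]) ->
  (box_count k P <= box_count l Q)%N.
Proof.
move=> fP; pose F (x : {ffun E -> 'I_k.+1}) := [ffun e => inord (f (nat_ffun x) e) : 'I_l.+1].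
have le_low (x : {ffun E -> 'I_k.+1}) e : (nat_ffun x e <= k)%N.
  by rewrite ffunE -ltnS ltn_ord.
have FE x : P (nat_ffun x) -> nat_ffun (F x) = f (nat_ffun x).
  move=> Px; have [fl _ _] := fP _ (le_low x) Px.
  by apply/ffunP=> e; rewrite !ffunE inordK // ltnS fl.
rewrite /box_count -(@card_in_imset _ _ F); last first.
  move=> x y; rewrite !inE => Px Py Fxy; apply: nat_ffun_inj.
  have [_ _ <-] := fP _ (le_low x) Px; have [_ _ <-] := fP _ (le_low y) Py.
  by rewrite -!FE // Fxy.
apply/subset_leq_card/subsetP=> _ /imsetP[x + ->]; rewrite !inE => Px.
by rewrite FE //; have [] := fP _ (le_low x) Px.
Qed.

End Counting.

(** * Half-open flow polytopes *)

Section Flows.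
Variables (E : finType) (V : vectType rat) (A : E -> V).
Implicit Types (D v : {set E}) (s : E -> bool) (x w : E -> int).

Definition flow s x : bool := \sum_e ((-1) ^+ s e * x e)%:~R *: A e == 0.

Definition flow_on D s x : bool := flow s x && [forall e, (e \notin D) ==> (x e == 0)].

Definition indic v : E -> int := fun e => (e \in v)%:Z.

Definition flip s v : E -> bool := fun e => s e (+) (e \in v).

Definition reflect_at v (t : int) x : E -> int :=
  fun e => if e \in v then t - x e else x e.

Definition int_fun (x : {ffun E -> nat}) : E -> int := fun e => (x e)%:Z.

Definition reflect_nat v (j : nat) (x : {ffun E -> nat}) : {ffun E -> nat} :=
  [ffun e => if e \in v then (j - x e)%N else x e].

(* The only property of graphs used for reciprocity: the orientation [s] may be
   arbitrary, since reflections reverse edges. *)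
Definition regular : Prop :=
  forall s x, (forall e, 0 <= x e) -> flow s x ->
  forall e, 0 < x e -> exists v, [/\ e \in v, (forall f, f \in v -> 0 < x f) & flow s (indic v)].

(* [w] and [u] may have any sign: for [u < 0] this is the half-open polytope seen
   from the point [w / u], with removed and kept facets exchanged. *)
Definition half_open D s w u (k : nat) (x : {ffun E -> nat}) : bool :=
  flow_on D s (int_fun x) &&
  [forall f in D, ((w f < 0) ==> (0 < x f)%N) && ((u < w f) ==> (x f < k)%N)].

(** The class [(e, j)]: for [e] in [D], among the edges of [D] where [x] reaches its maximum [j],
    [e] has the greatest [w]. The removal of upper facets is left to the range of [j]. *)
Definition max_at D s w e (j : nat) (x : {ffun E -> nat}) : bool :=
  [&& flow_on D s (int_fun x), x e == j &
  [forall f in D, [&& (x f <= j)%N, (w f < 0) ==> (0 < x f)%N & (w e < w f) ==> (x f < j)%N]]].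

(* For a generic [w], edges with equal values of [w] carry equal values of every
   flow, so one edge per value suffices. *)
Definition tie_rep D w e : bool := [pick f in D | w f == w e] == Some e.

(* [w] and [u] satisfy no small integral linear relation except those valid for
   all flows [x] and all integers [t].  A reflection multiplies the bound [M] by
   at most [#|E|.+2]. *)
Definition generic (M : nat) D s w (u : int) : Prop :=
  forall (c : E -> int) (c0 : int), (forall f, `|c f| <= M%:Z) -> `|c0| <= M%:Z ->
  c0 * u + \sum_f c f * w f = 0 ->
  forall x t, flow_on D s x -> c0 * t + \sum_f c f * x f = 0.

(** * Linearity and reflection of flows *)

Lemma flow_onP D s x : reflect (flow s x /\ forall e, e \notin D -> x e = 0) (flow_on D s x).
Proof.
apply: (iffP andP) => [[fx /forallP x0]|[fx x0]]; split=> //.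
  by move=> e eD; apply/eqP; exact: (implyP (x0 e)).
by apply/forallP=> e; apply/implyP=> eD; apply/eqP; exact: x0.
Qed.

Lemma eq_flow s s' x x' : s =1 s' -> x =1 x' -> flow s x = flow s' x'.
Proof.
by move=> ss xx; rewrite /flow; under eq_bigr => e _ do rewrite ss xx.
Qed.

Lemma eq_flow_on D s s' x x' : s =1 s' -> x =1 x' -> flow_on D s x = flow_on D s' x'.
Proof.
move=> ss xx; rewrite /flow_on (eq_flow ss xx); congr andb.
by apply: eq_forallb => e; rewrite xx.
Qed.

Lemma flow_lin s x y (a b : int) :
  flow s x -> flow s y -> flow s (fun e => a * x e + b * y e).
Proof.
move=> /eqP fx /eqP fy; rewrite /flow.
apply/eqP; transitivity (a%:~R *: (\sum_e ((-1) ^+ s e * x e)%:~R *: A e) +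
  b%:~R *: (\sum_e ((-1) ^+ s e * y e)%:~R *: A e)); last first.
  by rewrite fx fy !scaler0 addr0.
rewrite !scaler_sumr -big_split; apply: eq_bigr => e _ /=.
by rewrite !scalerA -scalerDl -!intrM -intrD; congr (_%:~R *: _); ring.
Qed.

Lemma flow_on_lin D s x y (a b : int) :
  flow_on D s x -> flow_on D s y -> flow_on D s (fun e => a * x e + b * y e).
Proof.
move=> /flow_onP[fx x0] /flow_onP[fy y0]; apply/flow_onP; split.
  exact: flow_lin.
by move=> e eD; rewrite x0 // y0 // !mulr0 addr0.
Qed.

Lemma flow_onN D s x : flow_on D s (fun e => - x e) = flow_on D s x.
Proof.
suff H x' : flow_on D s x' -> flow_on D s (fun e => - x' e).
  apply/idP/idP; last exact: H.
  by move/H; rewrite (@eq_flow_on _ _ s _ x) // => e; rewrite opprK.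
move=> fx; have := flow_on_lin (-1) 0 fx fx.
by rewrite (@eq_flow_on _ _ s _ (fun e => - x' e)) // => e; rewrite mul0r addr0 mulN1r.
Qed.

Lemma flow_indic_flip s v : flow s (indic v) -> flow (flip s v) (indic v).
Proof.
rewrite /flow => /eqP H; rewrite -oppr_eq0 -sumrN -{2}H; apply/eqP/eq_bigr => e _.
rewrite /flip /indic -scaleNr -intrN; case: (e \in v); last by rewrite !mulr0 oppr0.
by rewrite addbT !mulr1 signrN opprK.
Qed.

(** On [v] the sign changes and [t - x] replaces [x], so the signed values are those of
    [x - t * indic v], a combination of two flows. *)
Lemma flow_reflect s v t x :
  flow s (indic v) -> flow s x -> flow (flip s v) (reflect_at v t x).
Proof.
move=> fv fx; have := flow_lin 1 (- t) fx fv.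
rewrite /flow; congr (_ == _); apply: eq_bigr => e _; congr (_%:~R *: _).
rewrite /flip /reflect_at /indic; case: (e \in v) => /=.
  by rewrite addbT signrN; ring.
by rewrite addbF; ring.
Qed.

Lemma flow_on_reflect D s v t x : v \subset D ->
  flow s (indic v) -> flow_on D s x -> flow_on D (flip s v) (reflect_at v t x).
Proof.
move=> vD fv /flow_onP[fx x0]; apply/flow_onP; split; first exact: flow_reflect.
move=> e eD; rewrite /reflect_at ifN ?x0 //.
by apply: contra eD; apply: subsetP.
Qed.

Lemma flow_on_setD1 D s e x : flow_on (D :\ e) s x = flow_on D s x && (x e == 0).
Proof.
apply/flow_onP/andP => [[fx x0]|[/flow_onP[fx x0] /eqP xe]]; split=> //.
- apply/flow_onP; split=> // f fD; apply: x0; rewrite !inE negb_and.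
  by rewrite fD orbT.
- by apply/eqP/x0; rewrite !inE eqxx.
by move=> f; rewrite !inE negb_and negbK => /orP[/eqP->|/x0].
Qed.

Lemma flip_flip s v : flip (flip s v) v =1 s.
Proof. by move=> e; rewrite /flip -addbA addbb addbF. Qed.

Lemma reflect_atK v t x : reflect_at v t (reflect_at v t x) =1 x.
Proof. by move=> e; rewrite /reflect_at; case: (e \in v); rewrite ?subKr. Qed.

Lemma int_fun_reflect v j (x : {ffun E -> nat}) : (forall e, (x e <= j)%N) ->
  int_fun (reflect_nat v j x) =1 reflect_at v j%:Z (int_fun x).
Proof.
move=> xj e; rewrite /int_fun /reflect_at ffunE; case: ifP => // _.
by rewrite subzn.
Qed.

Lemma exists_tie_rep D w e : e \in D -> exists f, [/\ f \in D, w f = w e & tie_rep D w f].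
Proof.
move=> eD; case Ep: [pick f in D | w f == w e] => [f|]; last first.
  by move: Ep; case: pickP => // /(_ e); rewrite eD eqxx.
have /andP[fD /eqP fe] : (f \in D) && (w f == w e).
  by move: Ep; case: pickP => // g gP [<-].
by exists f; split=> //; rewrite /tie_rep fe Ep.
Qed.

Lemma tie_rep_in D w e : tie_rep D w e -> e \in D.
Proof. by rewrite /tie_rep; case: pickP => // f /andP[fD _] /eqP[<-]. Qed.

Lemma tie_rep_inj D w e f : tie_rep D w e -> tie_rep D w f -> w e = w f -> e = f.
Proof.
by move=> /eqP + /eqP + ef; rewrite ef => -> [].
Qed.

Lemma tie_repN D w e : tie_rep D (fun e => - w e) e = tie_rep D w e.
Proof.
by rewrite /tie_rep; congr (_ == _); apply: eq_pick => f /=; rewrite eqr_opp.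
Qed.

(** * Consequences of genericity *)

Lemma generic_weaken (M M' : nat) D s w u : (M <= M')%N -> generic M' D s w u -> generic M D s w u.
Proof.
move=> MM gw c c0 cM c0M; apply: gw => [f|]; last by rewrite (le_trans c0M) ?lez_nat.
by rewrite (le_trans (cM f)) ?lez_nat.
Qed.

Lemma genericN M D s w u : generic M D s w u -> generic M D s (fun e => - w e) (- u).
Proof.
move=> gw c c0 cM c0M H; apply: gw => //; apply: oppr_inj.
rewrite oppr0 -[RHS]H opprD mulrN; congr (_ + _).
by rewrite -sumrN; apply: eq_bigr => e _; rewrite mulrN.
Qed.

Lemma sum_delta e x : \sum_f (f == e)%:Z * x f = x e.
Proof.
rewrite (bigD1 e) //= eqxx mul1r big1 ?addr0 // => f /negPf->.
by rewrite mul0r.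
Qed.

(** The relation [u = 0] would have to hold for every integer [t], in particular for [t = 1]. *)
Lemma generic_neq0 D s w u : generic 1 D s w u -> u != 0.
Proof.
move=> gw; apply/eqP=> u0.
have := gw (fun=> 0) 1; rewrite u0 mulr0 add0r big1 => [|f _]; last by rewrite mul0r.
move=> /(_ (fun=> isT) isT erefl (fun=> 0) 1).
rewrite big1 => [|f _]; last by rewrite mul0r.
move=> H; suff /H : flow_on D s (fun=> 0) by [].
apply/flow_onP; split=> //; rewrite /flow big1 // => e _.
by rewrite mulr0 scale0r.
Qed.

Lemma flow_on0 D s x : x =1 (fun=> 0) -> flow_on D s x.
Proof.
move=> x0; rewrite (eq_flow_on D (frefl s) x0).
apply/flow_onP; split=> //; rewrite /flow big1 // => e _.
by rewrite mulr0 scale0r.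
Qed.

Lemma generic_neq D s w u e : generic 1 D s w u -> w e != u.
Proof.
move=> gw; apply/eqP=> weu.
have := gw (fun f => (f == e)%:Z) (-1); rewrite sum_delta weu mulN1r addNr.
have cM f : `|(f == e)%:Z| <= 1%:Z by case: eqP.
move=> /(_ cM isT erefl (fun=> 0) 1 (flow_on0 _ _ (frefl _))).
by rewrite sum_delta.
Qed.

Lemma generic_eq0 D s w u e x : generic 1 D s w u -> w e = 0 -> flow_on D s x -> x e = 0.
Proof.
move=> gw we fx.
have := gw (fun f => (f == e)%:Z) 0; rewrite sum_delta mul0r add0r we.
have cM f : `|(f == e)%:Z| <= 1%:Z by case: eqP.
by move=> /(_ cM isT erefl x 0 fx); rewrite sum_delta mul0r add0r.
Qed.

Lemma generic_eq D s w u e e' x :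
  generic 1 D s w u -> w e = w e' -> flow_on D s x -> x e = x e'.
Proof.
move=> gw we fx.
have SB y : \sum_f ((f == e)%:Z - (f == e')%:Z) * y f = y e - y e'.
  under eq_bigr => f _ do rewrite mulrBl.
  by rewrite sumrB !sum_delta.
have := gw (fun f => (f == e)%:Z - (f == e')%:Z) 0.
rewrite SB mul0r add0r we subrr.
have cM f : `|(f == e)%:Z - (f == e')%:Z| <= 1%:Z by do 2!case: eqP.
by move=> /(_ cM isT erefl x 0 fx) /eqP; rewrite SB mul0r add0r subr_eq0 => /eqP.
Qed.

(** * Classes of lattice points by their maximum *)

Lemma sum_bool_uniq (I : finType) (P : pred I) :
  (forall i j, P i -> P j -> i = j) -> (\sum_i P i)%N = [exists i, P i].
Proof.
move=> uP; case: existsP => [[i Pi]|nP]; last first.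
  by rewrite big1 // => i _; apply/eqP; rewrite eqb0; apply/negP=> Pi; apply: nP; exists i.
rewrite (bigD1 i) //= Pi big1 // => j ji; apply/eqP; rewrite eqb0.
by apply: contra ji => Pj; rewrite (uP _ _ Pj Pi).
Qed.

Lemma sum_max_at D s w e m (x : {ffun E -> nat}) :
  (\sum_(1 <= j < m.+1) max_at D s w e j x)%N
  = [&& (0 < x e)%N, (x e <= m)%N & max_at D s w e (x e) x].
Proof.
have [/andP[x0 xm]|nx] := boolP ((0 < x e) && (x e <= m))%N; last first.
  rewrite andbA (negPf nx) andFb big_nat big1 // => j /andP[j0 jm].
  by apply/eqP; rewrite eqb0 /max_at; apply: contra nx => /and3P[_ /eqP-> _]; rewrite j0.
rewrite x0 xm !andTb (bigD1_seq (x e)) ?mem_index_iota ?iota_uniq ?x0 //=; last first.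
rewrite big1 ?addn0 // => j jx; apply/eqP; rewrite eqb0 /max_at.
by rewrite [x e == j]eq_sym (negPf jx) andbF.
Qed.

(** The zero point survives exactly when no lower facet is removed. Any other point lies in exactly
    one class, whose maximum may equal [k] unless [u < w e]. *)
Lemma half_open_max_at D s w u k (x : {ffun E -> nat}) : (0 < k)%N -> generic 1 D s w u ->
  (forall e, (x e <= k)%N) ->
  half_open D s w u k x =
  ([forall e, x e == 0%N] && [forall f in D, (0 <= w f)%R] +
   \sum_(e | tie_rep D w e) \sum_(1 <= j < (k - (u < w e)%R).+1) max_at D s w e j x)%N :> nat.
Proof.
move=> k0 gw xk.
(* A point lies in at most one class, so the double sum is the truth value of an existence
   statement. *)
have -> : (\sum_(e | tie_rep D w e) \sum_(1 <= j < (k - (u < w e)%R).+1) max_at D s w e j x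
  = [exists e, [&& tie_rep D w e, (0 < x e)%N, (x e <= k - (u < w e)%R)%N
             & max_at D s w e (x e) x]])%N.
  rewrite -sum_bool_uniq => [|e f /and4P[re _ _ /and3P[_ _ /forallP me]]
    /and4P[rf _ _ /and3P[_ _ /forallP mf]]]; last first.
    apply: (tie_rep_inj re rf).
    have /and3P[fe _ fe'] := implyP (me f) (tie_rep_in rf).
    have /and3P[ef _ ef'] := implyP (mf e) (tie_rep_in re).
    have xef : x e = x f by apply/eqP; rewrite eqn_leq fe ef.
    apply/eqP; rewrite eq_le !leNgt; apply/andP; split; apply/negP.
      by move/(implyP ef'); rewrite xef ltnn.
    by move/(implyP fe'); rewrite xef ltnn.
  rewrite big_mkcond /=; apply: eq_bigr => e _.
  by rewrite sum_max_at; case: (tie_rep D w e).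
case: (boolP (half_open D s w u k x)) => [/andP[fx /forallP ho]|nho].
  have [/forallP x0|] := boolP [forall e, x e == 0%N].
    rewrite (_ : [forall f in D, 0 <= w f]) /=; last first.
      apply/forallP=> f; apply/implyP=> fD.
      have /andP[+ _] := implyP (ho f) fD; rewrite (eqP (x0 f)) ltnn implybF.
      by rewrite -leNgt.
    case: existsP => // -[e /and4P[_ + _ _]].
    by rewrite (eqP (x0 e)).
  rewrite negb_forall => /existsP[e0 xe0] /=.
  have fx0 e : e \notin D -> x e = 0%N.
    by move=> eD; have /flow_onP[_ /(_ e eD) []] := fx.
  have e0D : e0 \in D by apply: contraR xe0 => /fx0->.
  (* The class is found lexicographically: [e1] maximizes [x], [e2] maximizes [w] among the
     maximizers of [x], and [e3] represents the tie of [e2]; by genericity [x] has the same value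
     there. *)
  case: (arg_maxnP x e0D) => e1 e1D m1.
  have P1 : (e1 \in D) && (x e1 == x e1) by rewrite eqxx andbT.
  have := @Order.TotalTheory.arg_maxP _ _ _ e1 (fun e => (e \in D) && (x e == x e1)) w P1.
  case=> e2 /andP[e2D /eqP x2] m2.
  have [e3 [e3D w3 r3]] := exists_tie_rep w e2D.
  have x3 : x e3 = x e1.
    by rewrite -x2; have [] := generic_eq gw w3 fx.
  rewrite (_ : [exists e, _] = true) //; apply/existsP; exists e3; rewrite r3 x3.
  have x1 : (0 < x e1)%N by rewrite (leq_trans _ (m1 _ e0D)) // lt0n.
  rewrite x1 /=; apply/andP; split.
    have /andP[_ /implyP] := implyP (ho e3) e3D; rewrite x3.
    by case: (u < w e3) => [/(_ isT)|_]; rewrite ?subn0 //; lia.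
  rewrite /max_at fx x3 eqxx /=; apply/forallP=> f; apply/implyP=> fD.
  have le1 : (x f <= x e1)%N := m1 _ fD.
  rewrite le1 /=; have /andP[-> _] := implyP (ho f) fD; rewrite /=.
  apply/implyP=> w3f; rewrite ltn_neqAle le1 andbT; apply/eqP=> xf.
  have := m2 f; rewrite fD xf eqxx => /(_ isT) /=.
  by rewrite -w3 leNgt w3f.
case: existsP => [[e /and4P[re x0 xm /and3P[fx _ /forallP me]]]|_].
  case/negP: nho; rewrite /half_open fx; apply/forallP=> f; apply/implyP=> fD.
  have /and3P[fe -> /implyP fe'] := implyP (me f) fD; rewrite /=.
  (* If [u < w e], the maximum is at most [k - 1]; otherwise [w e <= u < w f] and the tie-break
     gives [x f < x e]. *)
  apply/implyP=> uw; case: (ltP u (w e)) xm => [ue|eu] xm.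
    by move: fe xm k0 => /=; lia.
  by move: (fe' (le_lt_trans eu uw)) xm => /=; lia.
rewrite addn0; case: (boolP [forall e, x e == 0%N]) => //= /forallP x0.
case: (boolP [forall f in D, 0 <= w f]) => //= /forallP w0.
case/negP: nho; apply/andP; split.
  by apply: flow_on0 => e; rewrite /int_fun (eqP (x0 e)).
apply/forallP=> f; apply/implyP=> fD; rewrite (eqP (x0 f)) k0 implybT andbT.
by rewrite ltNge (implyP (w0 f) fD).
Qed.

Lemma box_count_sum k (P : pred {ffun E -> nat}) :
  box_count k P = (\sum_(x : {ffun E -> 'I_k.+1}) P (nat_ffun x))%N.
Proof.
rewrite /box_count -sum1_card big_mkcond /=; apply: eq_bigr => x _.
by rewrite inE; case: (P _).
Qed.

Lemma max_at_le D s w e j (x : {ffun E -> nat}) : max_at D s w e j x -> forall f, (x f <= j)%N.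
Proof.
move=> /and3P[/flow_onP[_ x0] _ /forallP H] f.
have [/(implyP (H f)) /and3P[] //|/x0 []] := boolP (f \in D).
by move=> ->.
Qed.

Lemma box_count_max_at D s w e j k : (j <= k)%N ->
  box_count k (max_at D s w e j) = box_count j (max_at D s w e j).
Proof.
move=> jk; apply/eqP; rewrite eqn_leq; apply/andP; split.
  by apply: (@box_count_le _ _ _ _ _ id id) => x _ Hx; split=> //; exact: max_at_le Hx.
apply: (@box_count_le _ _ _ _ _ id id) => x xj Hx; split=> // f.
exact: leq_trans (xj f) jk.
Qed.

Lemma box_count_half_open D s w u k : (0 < k)%N -> generic 1 D s w u ->
  box_count k (half_open D s w u k) =
  ([forall f in D, (0 <= w f)%R] +
   \sum_(e | tie_rep D w e) \sum_(1 <= j < (k - (u < w e)%R).+1) box_count j (max_at D s w e j))%N.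
Proof.
move=> k0 gw; rewrite box_count_sum.
have xk (x : {ffun E -> 'I_k.+1}) e : (nat_ffun x e <= k)%N.
  by rewrite ffunE -ltnS ltn_ord.
rewrite (eq_bigr _ (fun (x : {ffun E -> 'I_k.+1}) _ => half_open_max_at k0 gw (xk x))).
rewrite big_split /=; congr addn.
  rewrite (bigD1 ([ffun=> ord0] : {ffun E -> 'I_k.+1})) //= big1 ?addn0 => [|x].
    by rewrite (_ : [forall e, _]) //; apply/forallP=> e; rewrite !ffunE.
  apply: contraNeq; rewrite eqb0 negbK => /andP[/forallP x0 _].
  apply/eqP/ffunP=> e; apply: val_inj; rewrite ffunE /=.
  by have := x0 e; rewrite ffunE => /eqP.
rewrite exchange_big; apply: eq_bigr => e _ /=.
rewrite exchange_big; apply: eq_big_nat => j /andP[_ jk] /=.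
rewrite -(@box_count_max_at _ _ _ _ _ k) ?box_count_sum //.
by rewrite (leq_trans _ (leq_subr (u < w e)%R k)) // -ltnS.
Qed.

Lemma reflect_natK v j (x : {ffun E -> nat}) : (forall e, (x e <= j)%N) ->
  reflect_nat v j (reflect_nat v j x) = x.
Proof.
move=> xj; apply/ffunP=> e; rewrite !ffunE; case: (e \in v) => //.
by rewrite subKn.
Qed.

Lemma reflect_nat_le v j (x : {ffun E -> nat}) : (forall e, (x e <= j)%N) ->
  forall e, (reflect_nat v j x e <= j)%N.
Proof. by move=> xj e; rewrite ffunE; case: ifP; rewrite ?leq_subr. Qed.

Lemma box_count_max_at_reflect D s w v e j : (0 < j)%N -> v \subset D -> e \in v ->
  flow s (indic v) ->
  box_count j (max_at D s w e j) =
  box_count j (half_open (D :\ e) (flip s v) (reflect_at v (w e) w) (w e) j).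
Proof.
move=> j0 vD ev fv; have eD := subsetP vD _ ev.
have fv' := flow_indic_flip fv.
apply/eqP; rewrite eqn_leq; apply/andP; split;
  apply: (@box_count_le _ _ _ _ _ (reflect_nat v j) (reflect_nat v j)) => x xj Hx;
  (split; [exact: reflect_nat_le| |exact: reflect_natK]).
  case/and3P: Hx => fx /eqP xe /forallP Hx; apply/andP; split.
    rewrite (eq_flow_on _ (frefl _) (int_fun_reflect v xj)) flow_on_setD1.
    by rewrite flow_on_reflect // /reflect_at ev /int_fun xe subrr.
  apply/forallP=> f; apply/implyP; rewrite !inE => /andP[fe fD].
  have /and3P[xf wl wu] := implyP (Hx f) fD.
  rewrite /reflect_at ffunE; case: ifP => _; last by rewrite wl wu.
  rewrite subn_gt0 subr_lt0 wu /= ltrBrDl gtrDr.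
  by apply/implyP=> /(implyP wl); lia.
case/andP: Hx; rewrite flow_on_setD1 => /andP[fx /eqP [xe]] /forallP Hx.
apply/and3P; split.
- rewrite (eq_flow_on _ (frefl _) (int_fun_reflect v xj)).
  by rewrite -(eq_flow_on _ (flip_flip s v) (frefl _)) flow_on_reflect.
- by rewrite ffunE ev xe subn0.
apply/forallP=> f; apply/implyP=> fD; rewrite ffunE.
have [->|fe] := eqVneq f e; first by rewrite ev xe subn0 leqnn j0 implybT ltxx.
have := implyP (Hx f); rewrite !inE fe fD => /(_ isT) /andP[].
rewrite /reflect_at; case: ifP => _; last by move=> -> ->; rewrite xj.
rewrite subr_lt0 ltrBrDl gtrDr => wl /implyP wu; rewrite leq_subr /=.
apply/andP; split; first by apply/implyP=> /wu; rewrite subn_gt0.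
by apply/implyP=> /(implyP wl); lia.
Qed.

Lemma eq_half_open D s w w' u u' k (x : {ffun E -> nat}) : w =1 w' -> u = u' ->
  half_open D s w u k x = half_open D s w' u' k x.
Proof.
by move=> ww <-; rewrite /half_open; congr andb; apply: eq_forallb => f; rewrite ww.
Qed.

Lemma reflect_atN v t x : reflect_at v (- t) (fun e => - x e) =1 (fun e => - reflect_at v t x e).
Proof. by move=> e; rewrite /reflect_at; case: ifP; rewrite // opprB addrC opprK. Qed.

Lemma generic_reflect M D s w u v e : v \subset D -> e \in v -> flow s (indic v) ->
  generic (#|E|.+2 * M) D s w u ->
  generic M (D :\ e) (flip s v) (reflect_at v (w e) w) (w e).
Proof.
move=> vD ev fv gw c c0 cM c0M.
pose c' f := (if f \in v then - c f else c f) + (f == e)%:Z * (c0 + \sum_(g in v) c g).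
have c'E x : c0 * x e + \sum_f c f * reflect_at v (x e) x f = 0 * 0 + \sum_f c' f * x f.
  rewrite mul0r add0r /c'; under [RHS]eq_bigr => f _ do rewrite mulrDl -mulrA.
  rewrite big_split /= sum_delta mulrDl mulr_suml [RHS]addrC -addrA; congr (_ + _).
  rewrite [X in X + _]big_mkcond -big_split /=; apply: eq_bigr => f _.
  by rewrite /reflect_at; case: ifP => _; rewrite ?add0r //; ring.
have c'M f : `|c' f| <= (#|E|.+2 * M)%N%:Z.
  have cN : `|if f \in v then - c f else c f| <= M%:Z by case: ifP; rewrite ?normrN.
  have cS : `|\sum_(g in v) c g| <= (#|E| * M)%N%:Z.
    apply: le_trans (ler_norm_sum _ _ _) _.
    apply: le_trans (ler_sum _ (fun g _ => cM g)) _.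
    rewrite sumr_const -mulr_natl -natz -natrM natz lez_nat leq_mul2r.
    by rewrite max_card orbT.
  rewrite /c'; case: (f == e); rewrite ?mul1r ?mul0r.
    by move: c0M cN cS; set S := \sum_(g in v) c g; lia.
  by rewrite addr0 (le_trans cN) // lez_nat; lia.
have refl_e x : reflect_at v (x e) x e = 0 by rewrite /reflect_at ev subrr.
move=> H y t; rewrite flow_on_setD1 => /andP[fy /eqP ye].
(* Every pair [(y, t)] on the smaller edge set comes from a flow on [D] whose value at [e] is
   [t]. *)
have fx : flow_on D s (reflect_at v t y).
  rewrite -(eq_flow_on _ (flip_flip s v) (frefl _)) flow_on_reflect //.
  exact: flow_indic_flip.
have xe : reflect_at v t y e = t by rewrite /reflect_at ev ye subr0.
have := gw c' 0 c'M isT; rewrite !mul0r !add0r.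
have := c'E w; rewrite H mul0r add0r => <- /(_ erefl _ 0 fx).
have := c'E (reflect_at v t y); rewrite xe mul0r !add0r => <-.
by under eq_bigr => f _ do rewrite reflect_atK.
Qed.
End Flows.

(** * Reciprocity for half-open flow polytopes *)

Section Reciprocity.
Variables (E : finType) (V : vectType rat) (A : E -> V).
Implicit Types (D v : {set E}) (s : E -> bool) (x w : E -> int).

(* The parity of the dimension of the space of flows supported in [D]. *)
Definition corank_sign D : rat := (-1) ^+ (#|D| + \dim (\sum_(e in D) <[A e]>)%VS).

(** The cycle puts [A e] in the span of the other vectors of [D], so the span keeps its dimension
    while [D] loses one element. *)
Lemma corank_signD1 D s v e : v \subset D -> e \in v -> flow A s (indic v) ->
  corank_sign (D :\ e) = - corank_sign D.
Proof.
move=> vD ev /eqP; have eD := subsetP vD _ ev.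
rewrite (bigD1 e) //= /indic ev mulr1 => /eqP; rewrite addr_eq0 => /eqP Ae.
have Amem : A e \in (\sum_(f in D :\ e) <[A f]>)%VS.
  have -> : A e = ((-1) ^+ s e)%:~R *: (((-1) ^+ s e)%:~R *: A e).
    by rewrite scalerA -intrM -expr2 sqrr_sign scale1r.
  rewrite Ae; apply/rpredZ; rewrite rpredN.
  apply: rpred_sum => f fe; have [fv|fv] := boolP (f \in v); last first.
    by rewrite mulr0 scale0r rpred0.
  apply/rpredZ/(subvP (sumv_sup f _ (subvv _))); last exact: memv_line.
  by rewrite !inE fe (subsetP vD).
have span_eq : (\sum_(f in D) <[A f]> = \sum_(f in D :\ e) <[A f]>)%VS.
  rewrite (bigD1 e) //=; rewrite (eq_bigl (fun f => f \in D :\ e)); last first.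
    by move=> f; rewrite !inE andbC.
  by apply/addv_idPr; rewrite -memvE.
by rewrite /corank_sign span_eq [in RHS](cardsD1 e) eD addSn exprS mulN1r opprK.
Qed.

(** A rational relation between the [A e] would become a nonzero flow after clearing denominators.
    So the vectors are independent and the exponent is twice [#|D|]. *)
Lemma corank_sign_free D s : (forall x, flow_on A D s x -> x =1 (fun=> 0)) ->
  corank_sign D = 1.
Proof.
move=> L0.
have dir : directv (\sum_(e in D) <[A e]>).
  apply/directv_sum_independent => y yA y0 e eD.
  have /fin_all_exists[c cE] : forall f, exists c : rat, f \in D -> y f = c *: A f.
    move=> f; have [fD|fD] := boolP (f \in D); last by exists 0.
    by have /vlineP[c] := yA f fD; exists c.
  pose d := \prod_f denq (c f).
  have d0 : d != 0 by apply/prodf_neq0 => f _; apply: denq_neq0.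
  (* This is [c f] times the common denominator [d], with a sign that undoes the one of [s]. *)
  pose x f := if f \in D then (-1) ^+ s f * (numq (c f) * \prod_(g | g != f) denq (c g)) else 0.
  have xE f : f \in D -> ((-1) ^+ s f * x f)%:~R = d%:~R * c f :> rat.
    move=> fD; rewrite /x fD mulrA -expr2 sqrr_sign mul1r /d
      [\prod_g denq (c g)](bigD1 f) //= !intrM.
    rewrite mulrAC; congr (_ * _).
    by rewrite -[X in _ = _ * X](divq_num_den (c f)) mulrC divfK ?intr_eq0 ?denq_neq0.
  have /L0/(_ e) : flow_on A D s x.
    apply/flow_onP; split=> [|f fD]; last by rewrite /x (negPf fD).
    rewrite /flow (bigID (fun f => f \in D)) /= [X in _ + X]big1 ?addr0; last first.
      by move=> f fD; rewrite /x (negPf fD) mulr0 scale0r.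
    rewrite (eq_bigr (fun f => d%:~R *: y f)) => [|f fD].
      by rewrite -scaler_sumr y0 scaler0.
    by rewrite xE // cE // scalerA.
  move=> xe; have := xE e eD; rewrite xe mulr0 => /esym/eqP.
  by rewrite mulf_eq0 intr_eq0 (negPf d0) /= => /eqP ce; rewrite cE // ce scale0r.
move: dir; rewrite /corank_sign directvE /= => /eqP->.
rewrite (eq_bigr (fun=> 1%N)) ?sum1_card ?addnn; first by rewrite -mul2n exprM sqrrN expr1n.
move=> e eD; rewrite dim_vline; case: eqP => // Ae.
suff /L0/(_ e) : flow_on A D s (indic [set e]) by rewrite /indic inE eqxx.
apply/flow_onP; split=> [|f fD].
  rewrite /flow (bigD1 e) //= Ae scaler0 add0r big1 // => f fe.
  by rewrite /indic inE (negPf fe) mulr0 scale0r.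
by rewrite /indic inE; case: eqP fD => // ->; rewrite eD.
Qed.

(** The counterpart of [max_at] with [w] itself in place of a lattice point; it describes the value
    at [0] of the polynomial of a class. *)
Definition top D w e : bool := (0 < w e) && [forall f in D, 0 <= w f <= w e].

Lemma sum_top D w (c : pred int) :
  (\sum_(e | tie_rep D w e && c (w e)) top D w e)%N
  = [exists e, [&& e \in D, c (w e) & top D w e]].
Proof.
rewrite big_mkcond (eq_bigr (fun e => nat_of_bool [&& tie_rep D w e, c (w e) & top D w e])).
  rewrite sum_bool_uniq; last first.
    move=> e f /and3P[re _ /andP[_ /forallP te]] /and3P[rf _ /andP[_ /forallP tf]].
    apply: (tie_rep_inj re rf); apply/le_anti/andP; split.
      by have /andP[] := implyP (tf e) (tie_rep_in re).
    by have /andP[] := implyP (te f) (tie_rep_in rf).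
  congr nat_of_bool; apply/existsP/existsP => -[e /and3P[re ce te]].
    by exists e; rewrite (tie_rep_in re) ce.
  have [f [fD wf rf]] := exists_tie_rep w re.
  by exists f; rewrite rf wf ce /top wf.
by move=> e _; case: (tie_rep D w e); case: (c (w e)).
Qed.

Lemma topN D w e : top D (fun f => - w f) e = (w e < 0) && [forall f in D, w e <= w f <= 0].
Proof.
rewrite /top oppr_gt0; congr andb; apply: eq_forallb => f.
by rewrite oppr_ge0 lerN2 andbC.
Qed.

Lemma exists_top D w : [forall f in D, 0 <= w f] -> [exists f in D, w f != 0] ->
  exists2 e, e \in D & top D w e.
Proof.
move=> /forallP w0 /existsP[e0 /andP[e0D we0]].
have := @Order.TotalTheory.arg_maxP _ _ _ e0 (fun e => e \in D) w e0D.
case=> e eD me; exists e => //; apply/andP; split.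
  apply: lt_le_trans (me _ e0D); rewrite lt_neqAle eq_sym we0.
  exact: (implyP (w0 e0)).
apply/forallP=> f; apply/implyP=> fD; rewrite (implyP (w0 f)) //=.
exact: me.
Qed.

Lemma sum_top_signed D w (z : rat) (c : pred int) :
  \sum_(e | tie_rep D w e && c (w e)) ((top D w e)%:R - z * (top D (fun f => - w f) e)%:R)
  = [exists e, [&& e \in D, c (w e) & top D w e]]%:R
    - z * [exists e, [&& e \in D, c (w e) & top D (fun f => - w f) e]]%:R.
Proof.
rewrite sumrB -mulr_sumr -!natr_sum sum_top; congr (_ - z * _%:R).
have := sum_top D (fun f => - w f) (fun t => c (- t)).
rewrite (eq_bigl (fun e => tie_rep D w e && c (w e))) => [->|e]; last by rewrite tie_repN opprK.
by congr nat_of_bool; apply: eq_existsb => e; rewrite opprK.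
Qed.

Lemma exists_top_all D w : [exists f in D, w f != 0] ->
  [exists e in D, top D w e] = [forall f in D, 0 <= w f].
Proof.
move=> wn0; apply/existsP/idP => [[e /andP[_ /andP[_ /forallP te]]]|w0].
  by apply/forallP=> f; apply/implyP=> /(implyP (te f)) /andP[].
by have [e eD te] := exists_top w0 wn0; exists e; rewrite eD.
Qed.

Lemma exists_top_zero D w (P : pred E) : ~~ [exists f in D, w f != 0] ->
  [exists e, [&& e \in D, P e & top D w e]] = false.
Proof.
move=> w0; apply: contraNF w0 => /existsP[e /and3P[eD _ /andP[we _]]].
by apply/existsP; exists e; rewrite eD gt_eqF.
Qed.

Lemma nonzeroN D w : [exists f in D, - w f != 0] = [exists f in D, w f != 0].
Proof. by apply: eq_existsb => f; rewrite oppr_eq0. Qed.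

Lemma all_zero D w : ~~ [exists f in D, w f != 0] -> forall f, f \in D -> w f = 0.
Proof.
rewrite negb_exists => /forallP w0 f fD.
by have := w0 f; rewrite fD negbK => /eqP.
Qed.

Lemma eq_forall_in D (P Q : pred E) : (forall f, f \in D -> P f = Q f) ->
  [forall f in D, P f] = [forall f in D, Q f].
Proof.
move=> PQ; apply: eq_forallb => f; case: (boolP (f \in D)) => //= fD.
exact: PQ.
Qed.

(** If [w] is nonzero on [D], it is nonnegative there exactly when some edge is [top], and one edge
    per value is summed, so [w] and [- w] contribute at most one term each. If [w] vanishes on [D],
    there is no top edge and [z = 1] balances the two sides. *)
Lemma face_sum_zero D w (z : rat) :
    (~~ [exists f in D, w f != 0] -> z = 1) ->
  [forall f in D, 0 <= w f]%:R -
    \sum_(e | tie_rep D w e) ((top D w e)%:R - z * (top D (fun f => - w f) e)%:R)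
  = z * [forall f in D, 0 <= - w f]%:R.
Proof.
move=> z1; have := sum_top_signed D w z xpredT.
rewrite (eq_bigl (tie_rep D w)) => [->|e]; last by rewrite andbT.
have [wn0|w0] := boolP [exists f in D, w f != 0].
  rewrite !exists_top_all ?nonzeroN //; ring.
rewrite !exists_top_zero ?nonzeroN // z1 //.
rewrite (@eq_forall_in _ _ xpredT) => [|f /(all_zero w0)->] //.
rewrite (@eq_forall_in _ (fun f => 0 <= - w f) xpredT) => [|f /(all_zero w0)->] //.
by rewrite mulr0 !subr0 mul1r.
Qed.

(** If [u < 0], every top edge of [w] satisfies [u < w e], so the terms without [z] cancel. If
    [0 < u], no top edge of [- w] satisfies it, so the terms with [z] vanish. *)
Lemma value_at_zero D w (u : int) (z : rat) : u != 0 -> (forall f, w f != u) ->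
    (~~ [exists f in D, w f != 0] -> z = 1) ->
  [forall f in D, 0 <= w f]%:R -
    \sum_(e | tie_rep D w e && (u < w e))
       ((top D w e)%:R - z * (top D (fun f => - w f) e)%:R)
  = ((0 < u) && [forall f in D, 0 <= w f <= u])%:R
    + z * ((u < 0) && [forall f in D, u <= w f <= 0])%:R.
Proof.
move=> u0 wu z1; rewrite (sum_top_signed D w z (fun t => u < t)).
have [wn0|w0] := boolP [exists f in D, w f != 0]; last first.
  rewrite !exists_top_zero ?nonzeroN // z1 //.
  rewrite (@eq_forall_in _ _ xpredT) => [|f /(all_zero w0)->] //.
  rewrite (@eq_forall_in _ (fun f => 0 <= w f <= u) (fun=> 0 <= u)) => [|f /(all_zero w0)->];
    last by rewrite lexx.
  rewrite (@eq_forall_in _ (fun f => u <= w f <= 0) (fun=> u <= 0)) => [|f /(all_zero w0)->];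
    last by rewrite lexx andbT.
  have all1 : [forall f in D, true] by apply/forallP=> f; rewrite implybT.
  rewrite all1 mulr0 !subr0 mul1r.
  case: (ltgtP u 0) u0 => // _ _; rewrite ?all1 /= ?addr0 ?add0r //.
case: (ltgtP u 0) u0 => // u0 _; rewrite /= ?mulr0 ?addr0 ?add0r.
- have -> : [exists e, [&& e \in D, u < w e & top D w e]] = [exists e in D, top D w e].
    apply: eq_existsb => e; case: (e \in D) => //=.
    by rewrite /top; case: (ltP 0 (w e)) => [we|_]; rewrite ?andbF // (lt_trans u0 we).
  rewrite exists_top_all // opprB addrC subrK; congr (_ * _%:R).
  congr nat_of_bool; apply/existsP/idP => [[e /and3P[eD ue]]|/forallP w0].
    rewrite topN => /andP[_ /forallP te]; apply/forallP=> f; apply/implyP.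
    by move=> /(implyP (te f)) /andP[wef ->]; rewrite (le_trans (ltW ue)).
  have [||e eD te] := @exists_top D (fun f => - w f); rewrite ?nonzeroN //.
    apply/forallP=> f; apply/implyP=> /(implyP (w0 f)) /andP[_].
    by rewrite oppr_ge0.
  exists e; rewrite eD te andbT lt_neqAle eq_sym wu.
  by have /andP[] := implyP (w0 e) eD.
have -> : [exists e, [&& e \in D, u < w e & top D (fun f => - w f) e]] = false.
  apply/existsP=> -[e /and3P[_ ue]]; rewrite topN => /andP[we _].
  by move: (lt_trans (lt_trans u0 ue) we); rewrite ltxx.
rewrite mulr0 subr0; case: (boolP [forall f in D, 0 <= w f]) => [w0|nw0]; last first.
  have -> : [forall f in D, 0 <= w f <= u] = false.
    apply: contraNF nw0 => /forallP w0; apply/forallP=> f; apply/implyP.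
    by move=> /(implyP (w0 f)) /andP[].
  case: existsP => [[e /and3P[_ _ /andP[_ /forallP te]]]|_]; last by rewrite subrr.
  case/negP: nw0; apply/forallP=> f; apply/implyP.
  by move=> /(implyP (te f)) /andP[].
have -> : [forall f in D, 0 <= w f <= u]
    = ~~ [exists e, [&& e \in D, u < w e & top D w e]]; last first.
  by case: [exists e, _]; rewrite ?subrr ?subr0.
apply/forallP/idP => [wle|nex f].
  rewrite negb_exists; apply/forallP=> e; case: (boolP (e \in D)) => //= eD.
  by have /andP[_] := implyP (wle e) eD; rewrite leNgt => /negPf->.
apply/implyP=> fD; rewrite (implyP (forallP w0 f) fD) /= leNgt.
have [e eD te] := exists_top w0 wn0.
apply: contraNN nex => uf; apply/existsP; exists e; rewrite eD te andbT.
apply: lt_le_trans uf _; have /andP[_ /forallP te'] := te.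
by have /andP[] := implyP (te' f) fD.
Qed.

Lemma eq_box_count_half_open D s w w' u u' k : w =1 w' -> u = u' ->
  box_count k (half_open A D s w u k) = box_count k (half_open A D s w' u' k).
Proof. by move=> ww uu; apply: eq_box_count => x _; apply: eq_half_open. Qed.

Lemma box_count_eq0 k (P : pred {ffun E -> nat}) :
  (forall x : {ffun E -> nat}, ~~ P x) -> box_count k P = 0%N.
Proof.
by move=> P0; apply: eq_card0 => x; rewrite inE; apply: negbTE.
Qed.

(** * Induction on the number of edges *)

Section Induction.
Hypothesis regA : regular A.

(** The value at [0] records whether [w / u] has its coordinates on [D] in [[0, 1]], with the corank
    sign when [u < 0]. It is part of the induction because summation to negative arguments uses
    it. *)
Definition recip D s w (u : int) (p : {poly rat}) : Prop :=
  [/\ forall k, (0 < k)%N -> p.[k%:R] = (box_count k (half_open A D s w u k))%:R,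
      forall k, (0 < k)%N -> p.[- k%:R] =
        corank_sign D * (box_count k (half_open A D s (fun f => - w f) (- u) k))%:R
    & p.[0] = ((0 < u) && [forall f in D, 0 <= w f <= u])%:R
              + corank_sign D * ((u < 0) && [forall f in D, u <= w f <= 0])%:R].

Definition face_recip D s w e (p : {poly rat}) : Prop :=
  [/\ forall k, (0 < k)%N -> p.[k%:R] = (box_count k (max_at A D s w e k))%:R,
      forall k, (0 < k)%N -> p.[- k%:R] =
        - (corank_sign D * (box_count k (max_at A D s (fun f => - w f) e k))%:R)
    & p.[0] = (top D w e)%:R - corank_sign D * (top D (fun f => - w f) e)%:R].

Lemma max_at_no_cycle D s w e : (forall v, v \subset D -> e \in v -> ~~ flow A s (indic v)) ->
  forall k (x : {ffun E -> nat}), (0 < k)%N -> ~~ max_at A D s w e k x.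
Proof.
move=> nov k x k0; apply/negP=> /and3P[/flow_onP[fx x0] /eqP xe _].
have [||v [ev vx fv]] := regA _ fx (e := e); rewrite /int_fun ?xe //.
suff vD : v \subset D by have := nov v vD ev; rewrite fv.
apply/subsetP=> f /vx; apply: contraLR => /x0; rewrite /int_fun => ->.
by rewrite ltxx.
Qed.

Lemma top_no_cycle D s w e : e \in D -> flow_on A D s w ->
  (forall v, v \subset D -> e \in v -> ~~ flow A s (indic v)) -> ~~ top D w e.
Proof.
move=> eD /flow_onP[fw w0] nov; apply/negP=> /andP[we /forallP te].
have [||v [ev vw fv]] := regA _ fw (e := e) => //.
  move=> f; have [fD|/w0->//] := boolP (f \in D).
  by have /andP[] := implyP (te f) fD.
suff vD : v \subset D by have := nov v vD ev; rewrite fv.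
by apply/subsetP=> f /vw; apply: contraLR => /w0 ->; rewrite ltxx.
Qed.

(** If a directed cycle in [D] passes through [e], the class is a reflected polytope with one edge
    less, and the corank sign changes. Otherwise regularity makes the class empty for positive [k],
    and the zero polynomial works. *)
Lemma face_reciprocity n D s w u e :
  (forall D' s' w' u', #|D'| = n -> flow_on A D' s' w' ->
     generic A (#|E|.+2 ^ n) D' s' w' u' -> exists p, recip D' s' w' u' p) ->
  #|D| = n.+1 -> flow_on A D s w -> generic A (#|E|.+2 ^ n.+1) D s w u ->
  e \in D -> exists p, face_recip D s w e p.
Proof.
move=> IHn cD fw gw eD.
have [[v /and3P[vD ev fv]]|nov] := existsP (P := fun v : {set E} =>
  [&& v \subset D, e \in v & flow A s (indic v)]); last first.
  have {}nov v : v \subset D -> e \in v -> ~~ flow A s (indic v).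
    by move=> vD ev; apply/negP=> fv; apply: nov; exists v; rewrite vD ev.
  exists 0; split=> [k k0|k k0|]; rewrite horner0 ?box_count_eq0 ?mulr0 ?oppr0 //.
  - by move=> x; apply: max_at_no_cycle.
  - by move=> x; apply: max_at_no_cycle.
  rewrite (negPf (top_no_cycle _ _ nov)) // (negPf (top_no_cycle _ _ nov)) ?flow_onN //.
  by rewrite mulr0 subr0.
have cD' : #|D :\ e| = n by move: cD; rewrite (cardsD1 e) eD => -[].
have [|||p [p1 p2 p3]] := IHn (D :\ e) (flip s v) (reflect_at v (w e) w) (w e) => //.
- rewrite flow_on_setD1 flow_on_reflect //= /reflect_at ev subrr //.
- by apply: (generic_reflect vD ev fv); rewrite -expnS; exact: gw.
exists p; split=> [k k0|k k0|].
- by rewrite p1 // (@box_count_max_at_reflect _ _ _ _ _ _ v).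
- rewrite p2 // (corank_signD1 vD ev fv) mulNr; congr (- (_ * _%:R)).
  rewrite (@box_count_max_at_reflect _ _ _ _ _ _ v) //.
  by apply: eq_box_count_half_open => // f; rewrite reflect_atN.
(* The map sending [w f] to [w e - w f] preserves the interval between [0] and [w e], so the
   inductive value at [0] is expressed by [top]. *)
rewrite p3 (corank_signD1 vD ev fv) mulNr topN; congr (_%:R - _ * _%:R).
  congr nat_of_bool; rewrite /top; case: (ltP 0 (w e)) => //= we.
  apply/forallP/forallP => H f; apply/implyP.
    move=> fD; have [->|fe] := eqVneq f e; first by rewrite lexx ltW.
    have := implyP (H f); rewrite !inE fe fD /reflect_at => /(_ isT).
    by case: ifP => _ //; lia.
  rewrite !inE => /andP[fe fD]; have := implyP (H f) fD.
  by rewrite /reflect_at; case: ifP => _ //; lia.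
congr nat_of_bool; case: (ltP (w e) 0) => //= we.
apply/forallP/forallP => H f; apply/implyP.
  move=> fD; have [->|fe] := eqVneq f e; first by rewrite lexx ltW.
  have := implyP (H f); rewrite !inE fe fD /reflect_at => /(_ isT).
  by case: ifP => _ //; lia.
rewrite !inE => /andP[fe fD]; have := implyP (H f) fD.
by rewrite /reflect_at; case: ifP => _ //; lia.
Qed.

(** The class of [e] is summed over [j] up to [k], or up to [k - 1] when [u < w e]; this explains
    the shift in the composed polynomial. *)
Lemma recip_of_faces D s w u : flow_on A D s w -> generic A 1 D s w u ->
  (forall e, e \in D -> exists p, face_recip D s w e p) -> exists p, recip D s w u p.
Proof.
move=> fw gw faces.
have /fin_all_exists[p pP] : forall e, exists p, e \in D -> face_recip D s w e p.
  by move=> e; case: (boolP (e \in D)) => [/faces[p]|]; [exists p|exists 0].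
have /fin_all_exists[S SP] e := summation_poly (p e).
have gNw := genericN gw.
have u0 := generic_neq0 gw; have wu f := generic_neq f gw.
have sgn1 : ~~ [exists f in D, w f != 0] -> corank_sign D = 1.
  move=> /all_zero w0; apply: (@corank_sign_free D s) => x fx f.
  have [fD|fD] := boolP (f \in D); first exact: (generic_eq0 gw (w0 f fD) fx).
  by have /flow_onP[_] := fx; apply.
have p0 e : tie_rep D w e ->
    (p e).[0] = (top D w e)%:R - corank_sign D * (top D (fun f => - w f) e)%:R.
  by move=> /tie_rep_in /pP[].
exists ([forall f in D, (0 <= w f)%R]%:R%:P +
  \sum_(e | tie_rep D w e) (S e \Po ('X - (u < w e)%R%:R%:P))).
have hornP z : ([forall f in D, (0 <= w f)%R]%:R%:P +
  \sum_(e | tie_rep D w e) (S e \Po ('X - (u < w e)%R%:R%:P))).[z] =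
  [forall f in D, 0 <= w f]%:R + \sum_(e | tie_rep D w e) (S e).[z - (u < w e)%R%:R].
  rewrite hornerD hornerC horner_sum; congr (_ + _).
  by apply: eq_bigr => e _; rewrite horner_comp hornerXsubC.
split=> [k k0|k k0|].
- rewrite hornP box_count_half_open // natrD natr_sum; congr (_ + _).
  apply: eq_bigr => e re; have [S0 SS] := SP e; have [pe _ _] := pP e (tie_rep_in re).
  rewrite -natrB; last by case: (u < w e).
  rewrite (summation_poly_pos S0 SS) natr_sum.
  by apply: eq_big_nat => j /andP[j0 _]; rewrite pe.
- rewrite hornP box_count_half_open // natrD natr_sum mulrDr.
  (* At negative arguments the terms [j = 0] are split off; together with the constant they give the
     contribution of the zero point for [- w]. *)
  rewrite -[X in X + _ = _](subrK (\sum_(e | tie_rep D w e) (p e).[0])).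
  rewrite (eq_bigr _ p0) face_sum_zero // -addrA; congr (_ + _).
  rewrite -(eq_bigr _ p0) -big_split /= mulr_sumr.
  rewrite [RHS](eq_bigl (tie_rep D w)) => [|e]; last by rewrite tie_repN.
  apply: eq_bigr => e re; have [S0 SS] := SP e; have [_ pe _] := pP e (tie_rep_in re).
  rewrite -opprD -natrD (summation_poly_neg S0 SS).
  (* As [w e] differs from [u], exactly one of [u < w e] and [- u < - w e] holds. *)
  have -> : (k + (u < w e)%R = (k - (- u < - w e)%R).+1)%N.
    by rewrite ltrN2; case: (ltgtP u (w e)) (wu e) => // _ _ /=; lia.
  rewrite [in LHS]big_nat_recl // mulr0n oppr0 opprD addrA subrr sub0r big_add1 /=.
  rewrite natr_sum mulr_sumr -sumrN; apply: eq_big_nat => j _.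
  by rewrite pe // opprK.
rewrite hornP -value_at_zero //; congr (_ + _).
(* Edges with [u < w e] contribute [S e] at [-1], which is minus [p e] at [0]; the others contribute
   [S e] at [0], which is zero. *)
rewrite (bigID (fun e => u < w e)) /= addrC big1 ?add0r => [|e /andP[re /negPf->]].
  rewrite -sumrN; apply: eq_bigr => e /andP[re ->].
  have [S0 SS] := SP e; rewrite -p0 // -SS S0.
  by rewrite [0 - (S e).[_]]sub0r opprK.
by rewrite subrr; have [] := SP e.
Qed.

(** The exponent [n] pays for one reflection, hence one factor [#|E|.+2], per edge of [D]. *)
Theorem half_open_reciprocity n D s w u : #|D| = n -> flow_on A D s w ->
  generic A (#|E|.+2 ^ n) D s w u -> exists p, recip D s w u p.
Proof.
elim: n D s w u => [|n IHn] D s w u cD fw gw; apply: recip_of_faces => //.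
- move=> e; have -> : D = set0 by apply/eqP; rewrite -cards_eq0 cD.
  by rewrite inE.
- by apply: generic_weaken gw; rewrite expn_gt0.
by move=> e eD; exact: (face_reciprocity IHn cD fw gw eD).
Qed.

End Induction.
End Reciprocity.

(** * Generic flows *)

Lemma dominant_eq0 (n a b : int) : `|b| < n -> n * a + b = 0 -> a = 0 /\ b = 0.
Proof.
move=> bn nab; suff a0 : a = 0 by move: nab; rewrite a0 mulr0 add0r.
apply: contraTeq bn => a0; rewrite -leNgt.
have -> : b = - (n * a) by apply/eqP; rewrite -addr_eq0 addrC nab.
rewrite normrN normrM; have a1 : 1 <= `|a| by lia.
rewrite (le_trans (ler_norm n)) // ler_peMr //.
Qed.

Section Generic.
Variables (E : finType) (V : vectType rat) (A : E -> V).

(** The relations are treated one at a time. If some [(x, t)] violates the next one, [(w, u)] is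
    replaced by [(N * w + x, N * u + t)] with [N] so large that a listed relation holds at the new
    point only if it holds at both [(w, u)] and [(x, t)]. *)
Lemma exists_generic_list (I : eqType) (r : seq I) (c : I -> E -> int) (c0 : I -> int)
    (s : E -> bool) (w0 : E -> int) :
  flow A s w0 -> (forall e, 0 < w0 e) ->
  exists (w : E -> int) (u : int),
    [/\ flow A s w, forall e, 0 < w e, forall e, w e < u, 0 < u
      & forall i, i \in r -> c0 i * u + \sum_f c i f * w f = 0 ->
        forall x t, flow A s x -> c0 i * t + \sum_f c i f * x f = 0].
Proof.
move=> fw0 w0_gt0; elim: r => [|i r [w [u [fw w_gt0 w_lt u_gt0 Hr]]]].
  exists w0, (1 + \sum_e w0 e); split=> // [e|]; last first.
    by rewrite ltr_pwDl // sumr_ge0 // => e _; rewrite ltW.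
  rewrite (bigD1 e) //= addrCA ltrDl ltr_pwDl // sumr_ge0 // => f _.
  exact: ltW.
have [[x [t [fx Hxt]]]|Hi] := classic (exists x t,
    flow A s x /\ c0 i * t + \sum_f c i f * x f != 0); last first.
  exists w, u; split=> // j; rewrite inE => /predU1P[-> _ x t fx|]; last exact: Hr.
  by apply/eqP; apply: contraT => nz; case: Hi; exists x, t.
pose ev j (y : E -> int) z := c0 j * z + \sum_f c j f * y f.
(* The first sums keep [0 < w] and [w < u] after the perturbation; the last one bounds all relations
   at [(x, t)]. *)
pose N := 1 + \sum_e `|x e| + `|t| + \sum_(j <- i :: r) `|ev j x t|.
have evN j : ev j (fun e => N * w e + x e) (N * u + t) = N * ev j w u + ev j x t.
  have -> : ev j (fun e => N * w e + x e) (N * u + t) =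
      c0 j * (N * u + t) + (N * (\sum_f c j f * w f) + \sum_f c j f * x f).
    rewrite mulr_sumr -big_split; congr (_ + _).
    by apply: eq_bigr => f _; rewrite /=; ring.
  by rewrite /ev; ring.
have sx0 : 0 <= \sum_e `|x e| by apply: sumr_ge0.
have se0 : 0 <= \sum_(j <- i :: r) `|ev j x t| by apply: sumr_ge0.
have xN e : `|x e| + `|t| < N.
  have : `|x e| <= \sum_e `|x e| by rewrite (bigD1 e) //= lerDl sumr_ge0.
  by rewrite /N; lia.
have eN j : j \in i :: r -> `|ev j x t| < N.
  move=> jr; have : `|ev j x t| <= \sum_(j <- i :: r) `|ev j x t|.
    by rewrite (big_rem j) //= lerDl sumr_ge0.
  by rewrite /N; lia.
have N1 : 1 <= N by rewrite /N; lia.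
exists (fun e => N * w e + x e), (N * u + t); split.
- have := flow_lin N 1 fw fx.
  by rewrite (@eq_flow _ _ _ _ s _ (fun e => N * w e + x e)) // => e; rewrite mul1r.
- by move=> e; have := w_gt0 e; have := xN e; nia.
- by move=> e; have := w_lt e; have := xN e; nia.
- suff : `|t| < N by move: u_gt0; nia.
  by rewrite /N; lia.
move=> j jr; have := evN j; rewrite {1}/ev => -> /(dominant_eq0 (eN j jr)) [ev0 evx].
move: jr; rewrite inE => /predU1P[ji|]; last by move/Hr; apply.
by move: Hxt; rewrite -ji -/(ev j x t) evx eqxx.
Qed.

(** Finitely many coefficient families are bounded by [M]; they are enumerated by ordinals shifted
    by [M]. *)
Lemma exists_generic M (s : E -> bool) (w0 : E -> int) :
  flow A s w0 -> (forall e, 0 < w0 e) ->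
  exists (w : E -> int) (u : int),
    [/\ flow_on A setT s w, generic A M setT s w u, forall e, 0 < w e,
      forall e, w e < u & 0 < u].
Proof.
move=> fw0 w0_gt0; pose I := ({ffun E -> 'I_M.*2.+1} * 'I_M.*2.+1)%type.
pose shift (i : 'I_M.*2.+1) : int := i%:Z - M%:Z.
have [w [u [fw w_gt0 w_lt u_gt0 Hi]]] :=
  exists_generic_list (enum {: I}) (fun i e => shift (i.1 e)) (fun i => shift i.2) fw0 w0_gt0.
have onT y : flow_on A setT s y = flow A s y.
  rewrite /flow_on (_ : [forall e, _]) ?andbT //.
  by apply/forallP=> e; rewrite inE.
exists w, u; split=> //; first by rewrite onT.
move=> c c0 cM c0M; pose unshift (z : int) : 'I_M.*2.+1 := inord (absz (z + M%:Z)).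
have shiftK z : `|z| <= M%:Z -> shift (unshift z) = z.
  by move=> zM; rewrite /shift /unshift inordK; lia.
have sumE y : \sum_f shift ([ffun e => unshift (c e)] f) * y f = \sum_f c f * y f.
  by apply: eq_bigr => f _; rewrite ffunE shiftK.
have := Hi ([ffun e => unshift (c e)], unshift c0); rewrite mem_enum => /(_ isT) /=.
rewrite shiftK // sumE => H /H {}H x t; rewrite onT => /H -/(_ t).
by rewrite sumE.
Qed.
End Generic.

(** * Cycles and cuts *)

Section Digraph.
Variables (E F : finType) (hd tl : E -> F).
Implicit Types (s : E -> bool) (x : E -> int) (R : {set F}).

Definition incidence e f : int := (hd e == f)%:Z - (tl e == f)%:Z.

Definition incidence_vec e : {ffun F -> rat^o} := [ffun f => (incidence e f)%:~R].

Lemma flowE s x : flow incidence_vec s x =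
  [forall f, \sum_e (-1) ^+ s e * x e * incidence e f == 0].
Proof.
have sumE f : (\sum_e ((-1) ^+ s e * x e)%:~R *: incidence_vec e) f
    = (\sum_e (-1) ^+ s e * x e * incidence e f)%:~R.
  rewrite sum_ffunE rmorph_sum; apply: eq_bigr => e _.
  by rewrite !ffunE [RHS]intrM.
apply/eqP/forallP => [fx f|fx].
  by rewrite -(@intr_eq0 rat) -sumE fx ffunE.
by apply/ffunP=> f; rewrite sumE (eqP (fx f)) ffunE.
Qed.

Definition arc_head s e : F := if s e then tl e else hd e.
Definition arc_tail (s : E -> bool) e : F := if s e then hd e else tl e.

Lemma signed_incidence s e f :
  (-1) ^+ s e * incidence e f = (arc_head s e == f)%:Z - (arc_tail s e == f)%:Z.
Proof.
rewrite /arc_head /arc_tail /incidence; case: (s e); rewrite ?expr0 ?expr1 ?mul1r //.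
by rewrite mulN1r opprB.
Qed.

Lemma flow_conservation s x : flow incidence_vec s x =
  [forall f, \sum_e x e * ((arc_head s e == f)%:Z - (arc_tail s e == f)%:Z) == 0].
Proof.
rewrite flowE; apply: eq_forallb => f; congr (_ == _); apply: eq_bigr => e _.
by rewrite -signed_incidence mulrCA mulrA.
Qed.

(** The conservation laws are added over the elements of [R]. *)
Lemma flow_cut s x (R : {set F}) : flow incidence_vec s x ->
  \sum_e x e * ((arc_head s e \in R)%:Z - (arc_tail s e \in R)%:Z) = 0.
Proof.
rewrite flow_conservation => /forallP fx.
have memE g : (g \in R)%:Z = \sum_(f in R) (g == f)%:Z.
  have [gR|gR] := boolP (g \in R).
    by rewrite (bigD1 g) //= eqxx big1 ?addr0 // => f /andP[_]; rewrite eq_sym => /negPf->.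
  by rewrite big1 // => f fR; case: eqP => // gf; rewrite gf fR in gR.
under eq_bigr => e _ do rewrite !memE -sumrB mulr_sumr.
by rewrite exchange_big big1 // => f _; exact/eqP/fx.
Qed.

Definition step s (P : pred E) : rel F :=
  [rel a b | [exists e, [&& P e, arc_tail s e == a & arc_head s e == b]]].

(** The sum telescopes along the path. Knowing that the tails precede the endpoint keeps each new
    edge out of [v], also when a cycle is closed. *)
Lemma path_flow s P a p : path (step s P) a p -> uniq (a :: p) ->
  exists v : {set E},
    [/\ forall e, e \in v -> P e && (arc_tail s e \in belast a p)
      & forall f, \sum_(e in v) ((arc_head s e == f)%:Z - (arc_tail s e == f)%:Z)
          = (last a p == f)%:Z - (a == f)%:Z].
Proof.
elim: p a => [|b p IHp] a /=.
  by move=> _ _; exists set0; split=> [e|f]; rewrite ?inE // big_set0 subrr.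
move=> /andP[/existsP[e /and3P[Pe /eqP se /eqP he]] bp] /andP[ab ubp].
have [v [vP vsum]] := IHp b bp ubp; exists (e |: v); split=> [g|f].
  rewrite !inE => /predU1P[->|/vP/andP[-> ->]]; rewrite ?orbT //.
  by rewrite Pe se eqxx.
rewrite big_setU1 /= ?vsum ?se ?he; first by ring.
apply/negP=> /vP /andP[_]; rewrite se => /mem_belast.
by rewrite (negPf ab).
Qed.

(** Minty's lemma: either arcs of [P] lead from the head of [e0] back to its tail, or the set
    reachable from the head is the required [R]. *)
Lemma cycle_or_cut s (P : pred E) e0 : P e0 ->
  (exists v : {set E}, [/\ e0 \in v, forall e, e \in v -> P e
     & flow incidence_vec s (indic v)]) \/
  (exists R, [/\ arc_head s e0 \in R, arc_tail s e0 \notin R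
     & forall e, P e -> arc_tail s e \in R -> arc_head s e \in R]).
Proof.
move=> Pe0; have [/connectP[p0 pp0 lp0]|nc] :=
  boolP (connect (step s P) (arc_head s e0) (arc_tail s e0)); [left|right].
  case/shortenP: pp0 lp0 => p pp up _ lp.
  have [v [vP vsum]] := path_flow pp up.
  have e0v : e0 \notin v.
    apply/negP=> /vP/andP[_]; rewrite lp; move: up.
    by rewrite lastI rcons_uniq => /andP[/negPf->].
  exists (e0 |: v); split; first by rewrite !inE eqxx.
    by move=> e; rewrite !inE => /predU1P[-> //|/vP/andP[]].
  rewrite flow_conservation; apply/forallP=> f.
  rewrite (bigID (fun e => e \in e0 |: v)) /= [X in _ + X]big1 ?addr0 => [|e nev]; last first.
    by rewrite /indic (negPf nev) mul0r.
  rewrite (eq_bigr (fun e => (arc_head s e == f)%:Z - (arc_tail s e == f)%:Z)) => [|e ev].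
    rewrite big_setU1 //= vsum -lp; apply/eqP; ring.
  by rewrite /indic ev mul1r.
exists [set b | connect (step s P) (arc_head s e0) b]; split; rewrite ?inE //.
move=> e Pe; rewrite !inE => /connect_trans; apply; apply: connect1.
by apply/existsP; exists e; rewrite Pe !eqxx.
Qed.

(** Otherwise some [R] is entered by [e0] and left by no edge of positive value, so the net flow
    into [R] is positive. *)
Lemma regular_incidence : regular incidence_vec.
Proof.
move=> s x x0 fx e0 xe0.
have [//|[R [hR sR closed]]] := cycle_or_cut s (P := fun e => 0 < x e) xe0.
have := flow_cut R fx; rewrite (bigD1 e0) //= hR (negPf sR) subr0 mulr1.
suff : 0 <= \sum_(e | e != e0) x e * ((arc_head s e \in R)%:Z - (arc_tail s e \in R)%:Z).
  by move=> S0 /eqP; rewrite gt_eqF // ltr_pwDl.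
apply: sumr_ge0 => e _; have := x0 e; rewrite le_eqVlt => /predU1P[<-|xe].
  by rewrite mul0r.
rewrite mulr_ge0 ?x0 //; case: (boolP (arc_tail s e \in R)) => [/(closed e xe)->|_].
  by rewrite subrr.
by rewrite subr0.
Qed.

Definition cut_sign s R e : int := (arc_head s e \in R)%:Z - (arc_tail s e \in R)%:Z.

Definition coherent_cut s R : bool :=
  [exists e, cut_sign s R e != 0] &&
  ([forall e, (cut_sign s R e != 0) ==> (cut_sign s R e == 1)] ||
   [forall e, (cut_sign s R e != 0) ==> (cut_sign s R e == -1)]).

(** The net flow through a cut is zero, but in a coherent cut its nonzero terms would all have the
    same sign. *)
Lemma positive_flow_no_coherent_cut s x R : flow incidence_vec s x ->
  (forall e, 0 < x e) -> ~~ coherent_cut s R.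
Proof.
move=> fx x0; apply/negP => /andP[/existsP[e0 ce0]].
have := flow_cut R fx; rewrite -[LHS]/(\sum_e x e * cut_sign s R e) => sum0.
have H (z : int) : z != 0 -> ~ (forall e, cut_sign s R e != 0 -> cut_sign s R e = z).
  move=> z0 cz; move/eqP: sum0; apply/negP.
  have ce e : x e * cut_sign s R e = z * (x e * (cut_sign s R e != 0)%:Z).
    by have [->|/cz->] := eqVneq (cut_sign s R e) 0; rewrite ?mulr0 // mulr1 mulrC.
  under eq_bigr => e _ do rewrite ce.
  rewrite -mulr_sumr mulf_neq0 // gt_eqF // (bigD1 e0) //= ce0 mulr1.
  rewrite ltr_pwDl // sumr_ge0 // => e _.
  by rewrite mulr_ge0 // ltW.
by case/orP=> /forallP c; [apply: (H 1)|apply: (H (-1))] => // e /(implyP (c e)) /eqP.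
Qed.

(** Without coherent cuts a directed cycle passes through each edge; the sum of these cycles is
    positive everywhere. *)
Lemma no_coherent_cut_positive_flow s : (forall R, ~~ coherent_cut s R) ->
  exists x, flow incidence_vec s x /\ forall e, 0 < x e.
Proof.
move=> nocut.
have /fin_all_exists[v vP] : forall e0 : E, exists v : {set E},
    e0 \in v /\ flow incidence_vec s (indic v).
  move=> e0; have [[v [ev _ fv]]|[R [hR sR closed]]] := cycle_or_cut s (P := predT) (e0 := e0) isT.
    by exists v.
  have /negP[] := nocut R; apply/andP; split.
    by apply/existsP; exists e0; rewrite /cut_sign hR (negPf sR).
  apply/orP; left; apply/forallP=> e; apply/implyP; rewrite /cut_sign.
  by case: (boolP (arc_tail s e \in R)) => [/(closed e isT)->|_] //; case: (_ \in _).
exists (fun e => \sum_g indic (v g) e); split=> [|e].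
  rewrite flow_conservation; apply/forallP=> f.
  under eq_bigr => e _ do rewrite mulr_suml.
  rewrite exchange_big big1 //= => g _; have [_] := vP g.
  by rewrite flow_conservation => /forallP/(_ f)/eqP.
rewrite (bigD1 e) //= ltr_pwDl ?sumr_ge0 // /indic.
by have [-> _] := vP e.
Qed.

End Digraph.

(** * Reciprocity for flows *)

Section FlowReciprocity.
Variables (E : finType) (V : vectType rat) (A : E -> V).
Hypothesis regA : regular A.

Definition nat_flow (s : E -> bool) (x : {ffun E -> nat}) : bool := flow A s (int_fun x).

Definition positive_flow (s : E -> bool) (x : {ffun E -> nat}) : bool :=
  nat_flow s x && [forall e, 0 < x e]%N.

Lemma box_count0_nat_flow s : box_count 0 (nat_flow s) = 1%N.
Proof.
rewrite /box_count (_ : [set x | _] = setT); first by rewrite cardsT card_ffun card_ord exp1n.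
apply/setP=> x; rewrite !inE /nat_flow (@eq_flow _ _ _ _ s _ (fun=> 0)) //.
  by apply/eqP; rewrite big1 // => e _; rewrite mulr0 scale0r.
by move=> e; rewrite /int_fun ffunE; case: (x e) => -[].
Qed.

Lemma corank_signM D : corank_sign A D * corank_sign A D = 1.
Proof. by rewrite /corank_sign -expr2 sqrr_sign. Qed.

Lemma flow_on_setT s x : flow_on A setT s x = flow A s x.
Proof.
rewrite /flow_on (_ : [forall e, _]) ?andbT //.
by apply/forallP=> e; rewrite inE.
Qed.

(** For generic [0 < w < u] no facet is removed, while [- w] and [- u] remove all of them. Positive
    flows with values below [k.+1] are those in the box of size [k], whence the shift by one. *)
Lemma flow_reciprocity s x0 : flow A s x0 -> (forall e, 0 < x0 e) ->
  exists p : {poly rat},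
    (forall k, p.[k.+1%:R] = (box_count k (positive_flow s))%:R) /\
    (forall k, p.[- k%:R] = corank_sign A setT * (box_count k (nat_flow s))%:R).
Proof.
move=> fx0 x0_gt0.
have [w [u [fw gw w0 wu u0]]] := exists_generic (#|E|.+2 ^ #|[set: E]|) fx0 x0_gt0.
have [p [p1 p2 p3]] := half_open_reciprocity regA erefl fw gw.
exists (corank_sign A setT *: (p \Po - 'X)).
have hornP z : (corank_sign A setT *: (p \Po - 'X)).[z] = corank_sign A setT * p.[- z].
  by rewrite hornerZ horner_comp hornerN hornerX.
split=> k; rewrite hornP ?opprK.
  rewrite p2 // mulrA corank_signM mul1r; congr _%:R; apply/eqP.
  rewrite eqn_leq; apply/andP; split;
    apply: (@box_count_le _ _ _ _ _ id id) => x xk; rewrite /half_open /positive_flow flow_on_setT.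
    move=> /andP[fx /forallP H]; rewrite /nat_flow /= fx; split=> // [e|].
      have := H e; rewrite inE /= oppr_lt0 w0 ltrN2 wu /=; lia.
    apply/forallP=> e; have := H e.
    by rewrite inE /= oppr_lt0 w0 ltrN2 wu => /andP[].
  move=> /andP[fx /forallP x0']; split=> // [e|]; first exact: leqW.
  rewrite /= (fx : flow A s (int_fun x)); apply/forallP=> e.
  by rewrite inE x0' ltnS xk !implybT.
congr (_ * _); case: k => [|k].
  rewrite p3 box_count0_nat_flow u0 [u < 0]ltNge ltW //= mulr0 addr0.
  by rewrite (_ : [forall f in _, _]) //; apply/forallP=> e; rewrite inE !ltW ?w0 ?wu.
rewrite p1 //; congr _%:R; apply: eq_box_count => x _.
rewrite /half_open flow_on_setT /nat_flow; case: (flow _ _ _) => //=.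
by apply/forallP=> e; rewrite inE /= !ltNge !ltW ?w0 ?wu.
Qed.

End FlowReciprocity.

Lemma card_le_can (T U : finType) (P : {set T}) (Q : {set U}) (f : T -> U) (g : U -> T) :
  (forall x, x \in P -> f x \in Q /\ g (f x) = x) -> (#|P| <= #|Q|)%N.
Proof.
move=> fP; rewrite -(@card_in_imset _ _ f) => [|x y Px Py fxy]; last first.
  by have [_ <-] := fP x Px; have [_ <-] := fP y Py; rewrite fxy.
by apply/subset_leq_card/subsetP=> _ /imsetP[x /fP[fx _] ->].
Qed.

Lemma sum_bool_cond (T : finType) (P Q : pred T) :
  (\sum_(t | P t) Q t = \sum_(t | P t && Q t) 1)%N.
Proof. by rewrite big_mkcondr; apply: eq_bigr => t _; case: (Q t). Qed.

(** * Local tensions as flows of the dual graph *)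

Section SurfaceGraph.
Variables (G : surface_graph) (sigma : orientation G).
Implicit Types (o : orientation G) (e : edge G) (R : {set face G}).

(** In the dual graph the arc of [e] runs from the face on its right to the face on its left. *)
Definition left_face e : face G := left (odart sigma e).
Definition right_face e : face G := left (dart_rev G (odart sigma e)).
Definition reversed o : edge G -> bool := fun e => ~~ agree o sigma e.

Lemma edge_of_odart o e : edge_of (odart o e) = e.
Proof. by have /forallP/(_ e)/eqP := valP o. Qed.

Lemma odartE o e : odart o e = if reversed o e then dart_rev G (odart sigma e) else odart sigma e.
Proof.
have := sg_edge_of (odart sigma e) (odart o e).
rewrite !edge_of_odart eqxx /reversed /agree => /esym.
by case: eqP => //= _ /eqP.
Qed.

Lemma headE o e : arc_head left_face right_face (reversed o) e = left (odart o e).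
Proof. by rewrite /arc_head odartE; case: (reversed o e). Qed.

Lemma sourceE o e : arc_tail left_face right_face (reversed o) e = left (dart_rev G (odart o e)).
Proof. by rewrite /arc_tail odartE; case: (reversed o e) => //; rewrite sg_revK. Qed.

Lemma adjacent_facesE o e :
  adjacent_faces e = [set left (odart o e); left (dart_rev G (odart o e))].
Proof.
apply/setP=> f; rewrite !inE; apply/imsetP/orP.
  move=> [d]; rewrite inE -{1}(edge_of_odart o e) eq_sym sg_edge_of => + ->.
  by case/orP=> /eqP->; [left|right].
have rev_e : edge_of (dart_rev G (odart o e)) = e.
  by apply/eqP; rewrite -{2}(edge_of_odart o e) eq_sym sg_edge_of eqxx orbT.
case=> /eqP->; [exists (odart o e)|exists (dart_rev G (odart o e))] => //.
  by rewrite inE edge_of_odart.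
by rewrite inE rev_e.
Qed.

(** Boundaries are cuts of the dual graph. An edge with the same face on both sides is a dual loop,
    which has sign zero in every cut. *)
Lemma boundary_vecE o R e : boundary_vec o R e = cut_sign left_face right_face (reversed o) R e.
Proof.
rewrite /boundary_vec /cut_sign headE sourceE inE (adjacent_facesE o).
set a := left _; set b := left _; have [->|ab] := eqVneq a b.
  by rewrite setUid cards1 subrr.
rewrite cards2 ab eqxx /=.
have -> : #|[set a; b] :&: R| = ((a \in R) + (b \in R))%N.
  rewrite -sum1_card; under eq_bigl => f do rewrite inE.
  rewrite big_mkcondr big_setU1 ?inE // big_set1.
  by case: (a \in R); case: (b \in R).
by case: (a \in R); case: (b \in R).
Qed.

Lemma mem_boundary o R e :
  (e \in boundary R) = (cut_sign left_face right_face (reversed o) R e != 0).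
Proof.
rewrite -boundary_vecE /boundary_vec; case: (e \in boundary R); rewrite ?eqxx //.
by case: (_ \in _).
Qed.

Lemma coherent_cutE o R : coherent_cut left_face right_face (reversed o) R =
  (boundary R != set0) && coherently_oriented o R.
Proof.
rewrite /coherent_cut /coherently_oriented; congr (_ && (_ || _)).
- apply/existsP/set0Pn => -[e]; first by rewrite -mem_boundary; exists e.
  by rewrite (mem_boundary o); exists e.
- by apply: eq_forallb => e; rewrite boundary_vecE.
by apply: eq_forallb => e; rewrite boundary_vecE.
Qed.

Notation incid := (incidence_vec left_face right_face).

Lemma boundary_acyclicP o : reflect (exists x, flow incid (reversed o) x /\ forall e, 0 < x e)
  (boundary_acyclic o).
Proof.
apply: (iffP idP) => [bo|[x [fx x0]]].
  apply: no_coherent_cut_positive_flow => R; rewrite coherent_cutE.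
  by apply/negP=> cR; case/existsP: bo; exists R.
apply/existsP=> -[R]; rewrite -coherent_cutE; apply/negP.
exact: positive_flow_no_coherent_cut fx x0.
Qed.

Lemma reversed_sigma : reversed sigma =1 (fun=> false).
Proof. by move=> e; rewrite /reversed /agree eqxx. Qed.

Lemma local_tensionE (t : edge G -> int) : local_tension sigma t = flow incid (fun=> false) t.
Proof.
rewrite flow_conservation; apply: eq_forallb => f; congr (_ == _).
rewrite big_mkcond; apply: eq_bigr => e _.
rewrite (mem_boundary sigma) boundary_vecE /cut_sign /arc_head /arc_tail reversed_sigma !inE.
by case: eqVneq => [->|_]; rewrite ?mulr0 // mulrC.
Qed.

Lemma local_tension_signed o x :
  local_tension sigma (fun e => (-1) ^+ reversed o e * x e) = flow incid (reversed o) x.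
Proof.
rewrite local_tensionE /flow; congr (_ == _); apply: eq_bigr => e _.
by rewrite mul1r.
Qed.

Lemma compatible_signed o (t : edge G -> int) : compatible sigma t o ->
  forall e, t e = (-1) ^+ reversed o e * `|t e|.
Proof.
move=> /forallP ct e; have := ct e; rewrite /reversed.
by case: (agree o sigma e) => /=; case: (ltgtP (t e) 0) => //= te _; lia.
Qed.

Lemma signed_compatible o (x : edge G -> int) : (forall e, 0 <= x e) ->
  compatible sigma (fun e => (-1) ^+ reversed o e * x e) o.
Proof.
move=> x0; apply/forallP=> e; have := x0 e; rewrite /reversed.
by case: (agree o sigma e) => /=; lia.
Qed.

(** A compatible [t] is recovered from its absolute value, the signs being given by [o]. The flag
    [b] restricts the count to nowhere-zero tensions. *)
Lemma card_compatible_tensions o k (b : bool) :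
  #|[set t in klocal_tensions sigma k.+1 | compatible sigma (fun e => kval (t e)) o
      && [forall e, b ==> (kval (t e) != 0)]]|
  = box_count k (fun x => nat_flow incid (reversed o) x && [forall e, b ==> (0 < x e)%N]).
Proof.
pose F (t : {ffun edge G -> kvalue k.+1}) : {ffun edge G -> 'I_k.+1} :=
  [ffun e => inord (absz (kval (t e)))].
pose unF (x : {ffun edge G -> 'I_k.+1}) : {ffun edge G -> kvalue k.+1} :=
  [ffun e => inord (absz ((-1) ^+ reversed o e * (x e : nat)%:Z + k%:Z))].
have kvalE (i : kvalue k.+1) : kval i = (i : nat)%:Z - k%:Z by [].
have ordk (i : kvalue k.+1) : (i < k.*2.+1)%N := ltn_ord i.
have FE t e : (F t e : nat) = absz (kval (t e)).
  by rewrite ffunE inordK // kvalE; have := ordk (t e); lia.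
have unFE x e : kval (unF x e) = (-1) ^+ reversed o e * (x e : nat)%:Z.
  rewrite kvalE ffunE (@inordK k.*2); have := ltn_ord (x e);
  by case: (reversed o e); rewrite ?expr0 ?expr1; lia.
apply/eqP; rewrite eqn_leq; apply/andP; split.
  apply: (card_le_can (f := F) (g := unF)) => t; rewrite !inE.
  move=> /andP[lt /andP[ct /forallP nz]]; have tE := compatible_signed ct.
  split.
    apply/andP; split.
      rewrite /nat_flow -local_tension_signed; move: lt.
      rewrite !local_tensionE; congr is_true; apply: eq_flow => // e.
      by rewrite /int_fun ffunE FE [LHS]tE abszE.
    apply/forallP=> e; apply/implyP=> bt; rewrite ffunE FE absz_gt0.
    exact: (implyP (nz e)).
  apply/ffunP=> e; apply: val_inj; suff /eqP : kval (unF (F t) e) = kval (t e).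
    by rewrite !kvalE /=; lia.
  by rewrite unFE FE [RHS]tE abszE.
apply: (card_le_can (f := unF) (g := F)) => x; rewrite !inE => /andP[fx /forallP nz].
split.
  apply/and3P; split.
  - move: fx; rewrite /nat_flow -local_tension_signed !local_tensionE; congr is_true.
    by apply: eq_flow => // e; rewrite unFE /int_fun ffunE.
  - have := @signed_compatible o (fun e => (x e : nat)%:Z) (fun e => isT).
    by congr is_true; apply: eq_forallb => e; rewrite unFE.
  apply/forallP=> e; apply/implyP=> /(implyP (nz e)); rewrite ffunE unFE.
  by move=> x0; rewrite mulf_neq0 ?signr_eq0 //; move: x0; case: (x e : nat).
apply/ffunP=> e; apply: val_inj; rewrite /= FE unFE.
by case: (reversed o e); rewrite ?expr0 ?expr1; lia.
Qed.

Lemma orientation_of_reversed (s : edge G -> bool) : exists o, reversed o =1 s.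
Proof.
have os : [forall e, edge_of ([ffun e => if s e then dart_rev G (odart sigma e)
                                else odart sigma e] e) == e].
  apply/forallP=> e; rewrite ffunE; case: (s e); last by rewrite edge_of_odart.
  by rewrite -{2}(edge_of_odart sigma e) eq_sym sg_edge_of eqxx orbT.
exists (exist (fun o : {ffun edge G -> dart G} =>
  is_true [forall e, edge_of (o e) == e]) _ os : orientation G) => e.
rewrite /reversed /agree /odart /= ffunE.
by case: (s e); rewrite ?eqxx // sg_rev_neq.
Qed.

Lemma reversed_inj o o' : reversed o =1 reversed o' -> o = o'.
Proof.
move=> oo'; apply: val_inj; apply/ffunP => e.
by rewrite -[LHS]/(odart o e) -[RHS]/(odart o' e) (odartE o) (odartE o') oo'.
Qed.

Lemma unique_compatible (t : edge G -> int) : (forall e, t e != 0) ->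
  (\sum_o compatible sigma t o)%N = 1%N.
Proof.
move=> nz; rewrite sum_bool_uniq => [|o o' co co'].
  have [o os] := orientation_of_reversed (fun e => t e < 0).
  case: existsP => // -[]; exists o; apply/forallP=> e; have := os e.
  by rewrite /reversed; case: (agree o sigma e) => /=; case: (ltgtP (t e) 0).
apply: reversed_inj => e; have := compatible_signed co e; have := compatible_signed co' e.
by have := nz e; case: (reversed o e); case: (reversed o' e); rewrite ?expr0 ?expr1; lia.
Qed.

(** A nowhere-zero tension is compatible with exactly one orientation, the one given by its signs,
    so it is counted once. *)
Lemma tau_loc_sum k : tau_loc sigma k.+1 =
  (\sum_o box_count k (positive_flow incid (reversed o)))%N.
Proof.
transitivity (\sum_o #|[set t in klocal_tensions sigma k.+1 |
  compatible sigma (fun e => kval (t e)) o && [forall e, true ==> (kval (t e) != 0)]]|)%N.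
  rewrite /tau_loc -sum1_card.
  under [RHS]eq_bigr => o _ do rewrite -sum1_card.
  rewrite [RHS](eq_bigr (fun o => \sum_(t in [set t in klocal_tensions sigma k.+1 |
     [forall e : edge G, kval (t e) != 0]]) compatible sigma (fun e => kval (t e)) o)%N).
    rewrite exchange_big; apply: eq_bigr => t; rewrite inE => /andP[_ /forallP nz].
    by rewrite /= unique_compatible.
  move=> o _; rewrite sum_bool_cond; apply: eq_bigl => t; rewrite !inE -andbA.
  by congr andb; rewrite andbC.
by apply: eq_bigr => o _; rewrite card_compatible_tensions.
Qed.

Lemma card_compatible_pairs k : #|compatible_pairs sigma k.+1| =
  (\sum_(o | boundary_acyclic o) box_count k (nat_flow incid (reversed o)))%N.
Proof.
under [RHS]eq_bigr => o _.
  rewrite (_ : box_count _ _ = \sum_(t | (t \in klocal_tensions sigma k.+1) &&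
    compatible sigma (fun e => kval (t e)) o) 1)%N; last first.
    transitivity (box_count k (fun x =>
        nat_flow incid (reversed o) x && [forall e, false ==> (0 < x e)%N])).
      by apply: eq_box_count => x _; rewrite (_ : [forall e, _]) ?andbT //; apply/forallP.
    rewrite -card_compatible_tensions -sum1_card; apply: eq_bigl => t; rewrite inE.
    by rewrite (_ : [forall e, _]) ?andbT //; apply/forallP.
  over.
rewrite pair_big_dep /= -sum1_card.
rewrite (reindex_onto (fun p => (p.2, p.1)) (fun p => (p.2, p.1))) /= => [|[] //].
apply: eq_bigl => -[o t] /=; rewrite eqxx andbT inE /=.
by case: (t \in _); case: (boundary_acyclic o).
Qed.

Lemma card_boundary_acyclic : #|[set o : orientation G | boundary_acyclic o]| =
  (\sum_(o | boundary_acyclic o) box_count 0 (nat_flow incid (reversed o)))%N.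
Proof.
rewrite -sum1_card; under [RHS]eq_bigr => o _ do rewrite box_count0_nat_flow.
by apply: eq_bigl => o; rewrite inE.
Qed.

(** An orientation that is not boundary acyclic carries no positive flow, and the zero polynomial
    serves. *)
Lemma flow_count_poly o : exists p : {poly rat},
  (forall k, p.[k.+1%:R] = (box_count k (positive_flow incid (reversed o)))%:R) /\
  (forall k, p.[- k%:R] = corank_sign incid setT *
     (boundary_acyclic o * box_count k (nat_flow incid (reversed o)))%:R).
Proof.
have [[x [fx x0]]|nb] := boundary_acyclicP o.
  have [p [p1 p2]] := flow_reciprocity (@regular_incidence _ _ _ _) fx x0.
  by exists p; split=> // k; rewrite mul1n.
exists 0; split=> k; rewrite horner0; last by rewrite mul0n mulr0.
rewrite box_count_eq0 // => x; apply/negP=> /andP[fx /forallP x0].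
by case: nb; exists (int_fun x); split=> // e; rewrite /int_fun ltz_nat.
Qed.

(** The corank sign is the same for all orientations, so the counts at [- k] add up without
    cancellation and the absolute value removes the sign. *)
Lemma tau_loc_poly : exists p : {poly rat},
  [/\ forall k, p.[k.+1%:R] = (tau_loc sigma k.+1)%:R,
      forall k, `|p.[- k%:R]| = #|compatible_pairs sigma k.+1|%:R
    & `|p.[0]| = #|[set o : orientation G | boundary_acyclic o]|%:R].
Proof.
have /fin_all_exists[p pP] := flow_count_poly.
have pN k : (\sum_o p o).[- k%:R] = corank_sign incid setT *
    (\sum_(o | boundary_acyclic o) box_count k (nat_flow incid (reversed o)))%:R.
  rewrite horner_sum [in RHS]big_mkcond natr_sum mulr_sumr; apply: eq_bigr => o _.
  by have [_ ->] := pP o; case: boundary_acyclic; rewrite ?mul1n ?mul0n.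
have norm1 : `|corank_sign incid setT| = 1 by rewrite normrX normrN1 expr1n.
exists (\sum_o p o); split=> [k|k|].
- rewrite horner_sum tau_loc_sum natr_sum; apply: eq_bigr => o _.
  by have [->] := pP o.
- by rewrite pN card_compatible_pairs normrM norm1 mul1r normr_nat.
by have := pN 0; rewrite oppr0 => ->; rewrite card_boundary_acyclic normrM norm1 mul1r normr_nat.
Qed.

End SurfaceGraph.

(** * Uniqueness of the quasipolynomial *)

Lemma poly_eq_on_progression (p q : {poly rat}) (a : rat) (d : nat) : (0 < d)%N ->
  (forall j : nat, p.[a + (d * j)%:R] = q.[a + (d * j)%:R]) -> p = q.
Proof.
move=> d0 pq; apply/eqP; rewrite -subr_eq0; apply: contraT => nz.
pose r := [seq a + (d * j)%:R | j <- iota 0 (size (p - q))].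
have /(max_poly_roots nz) : all (root (p - q)) r.
  by apply/allP=> _ /mapP[j _ ->]; rewrite rootE hornerD hornerN pq subrr.
rewrite size_map size_iota ltnn => -> //.
rewrite map_inj_uniq ?iota_uniq // => i j /addrI/eqP.
by rewrite eqr_nat eqn_pmul2l // => /eqP.
Qed.

(** On the residue class of [n] modulo the period, [q] is given by one polynomial, which agrees with
    [p] at infinitely many positive integers. *)
Lemma quasipolynomial_eq (q : int -> rat) (p : {poly rat}) : quasipolynomial q ->
  (forall k : nat, (0 < k)%N -> q k%:Z = p.[k%:R]) -> forall n, q n = p.[n%:~R].
Proof.
move=> [m [c [m0 cm qc]]] qp n.
have cmj j : c (n + (m * j)%N%:Z) = c n.
  elim: j => [|j IHj]; first by rewrite muln0 addr0.
  by rewrite mulnSr PoszD addrA cm.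
rewrite qc; congr _.[_].
(* This many periods added to [n] give a positive integer. *)
pose j0 := (absz n).+1.
apply: (@poly_eq_on_progression _ _ (n + (m * j0)%N%:Z)%:~R m) => // j.
have nj : n + (m * j0)%N%:Z + (m * j)%N%:Z = n + (m * (j0 + j))%N%:Z.
  by rewrite mulnDr PoszD addrA.
have pos : exists2 l : nat, (0 < l)%N & n + (m * (j0 + j))%N%:Z = l%:Z.
  have big : (absz n < m * (j0 + j))%N.
    by rewrite (leq_trans _ (leq_pmull _ m0)) // ltnS leq_addr.
  move: big; set b := (m * (j0 + j))%N => big.
  by exists (absz (n + b%:Z)); lia.
have -> : (n + (m * j0)%N%:Z)%:~R + (m * j)%:R = (n + (m * (j0 + j))%N%:Z)%:~R :> rat.
  by rewrite -nj [RHS]intrD.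
by rewrite -(cmj (j0 + j)%N) -qc; have [l l0 ->] := pos; rewrite qp.
Qed.

Theorem theorem4p11 (G : surface_graph) (sigma : orientation G) :
  (exists q : int -> rat, is_tau_loc_quasipolynomial sigma q) /\
  (forall q : int -> rat, is_tau_loc_quasipolynomial sigma q ->
     (forall k : nat,
        `|q (- k%:Z)| = #|compatible_pairs sigma k.+1|%:R) /\
     `|q 0| = #|[set o : orientation G | boundary_acyclic o]|%:R).
Proof.
have [p [pP pN p0]] := tau_loc_poly sigma; split.
  exists (fun n => p.[n%:~R]); split; last by case=> // k _; exact: pP.
  by exists 1%N, (fun=> p); split.
move=> q [qq qt].
have qE n : q n = p.[n%:~R].
  by apply: quasipolynomial_eq n => // -[//|k] _; rewrite qt // pP.
by split=> [k|]; rewrite qE // mulrNz pN.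
Qed.
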